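(* Let $\varphi\in\mathcal{C}^1(E,\mathbb{R})$, $S\subset M$, $a\in\mathbb{R}$, $\varepsilon,\delta>0$ be such that $$u\in M\cap\varphi^{-1}([a-2\varepsilon,a+2\varepsilon])\cap S_{2\delta}\ \Rightarrow\ \left\|\varphi|_M'(u)\right\|\ge\frac{8\varepsilon}\delta.$$ Then there exists $\eta\in\mathcal{C}([0,1]\times M,M)$ such that (i) $\eta(t,u)=u$ if $t=0$, or if $u\notin M\cap\varphi^{-1}([a-2\varepsilon,a+2\varepsilon])\cap S_{2\delta}$; (ii) $\eta(1,\varphi^{a+\varepsilon}\cap S)\subset\varphi^{a-\varepsilon}$; (iii) for every $t\in[0,1]$, $\eta(t,\cdot):M\to M$ is a homeomorphism; (iv) $\|\eta(t,u)-u\|_E\le\delta$ for all $u\in M$, $t\in[0,1]$; (v) for every $u\in M$, $\varphi(\eta(t,u))$ is non-increasing in $t\in[0,1]$; (vi) $\varphi(\eta(t,u))<a$ for all $u\in M\cap\varphi^a\cap S_\delta$ and $t\in(0,1]$.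
   Context: $H$ is a real Hilbert space with scalar product $(\cdot,\cdot)_H$ and norm $\|\cdot\|_H$, $E$ is a real Banach space with norm $\|\cdot\|_E$, both infinite dimensional, with continuous injections $E\hookrightarrow H\hookrightarrow E^*$ ($E^*$ the dual of $E$, $H$ identified with its dual). $M:=\{u\in E:\|u\|_H=1\}$ with the topology inherited from $E$; $T_uM=\{v\in E:(u,v)_H=0\}$ for $u\in M$. For $u\in M$, $\|\varphi|_M'(u)\|:=\sup\{|\langle\varphi'(u),v\rangle|:v\in T_uM,\ \|v\|_E=1\}$. For $S\subset E$ and $\delta>0$, $S_\delta:=\{v\in E:\|u-v\|_E<\delta\text{ for some }u\in S\}$. For $b\in\mathbb{R}$, $\varphi^b:=\{u\in E:\varphi(u)\le b\}$. *)

(* Defs.v *)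
From HB Require Import structures.
From mathcomp Require Import all_boot all_order all_algebra sesquilinear.
From mathcomp Require Import all_classical all_reals all_analysis.
Import Order.TTheory GRing.Theory Num.Theory.
Import numFieldNormedType.Exports.

Set Implicit Arguments.
Unset Strict Implicit.
Unset Printing Implicit Defensive.

Local Open Scope classical_set_scope.
Local Open Scope ring_scope.

Definition infinite_dimensional (R : realType) (V : lmodType R) : Prop :=
  forall (n : nat) (e : 'I_n -> V),
    exists v : V, forall c : 'I_n -> R, v <> \sum_(k < n) c k *: e k.

Definition homeomorphism (X Y : topologicalType) (f : X -> Y) : Prop :=
  continuous f /\
  exists g : Y -> X, [/\ cancel f g, cancel g f & continuous g].

Section ConstrainedFunctional.
Variables (R : realType) (E H : completeNormedModType R).

(* The real [sup] is junk on empty or unbounded sets. This function is only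
   used on continuous linear functionals [f] and on subspaces [T] of
   codimension at most 1 in an infinite-dimensional [E], for which the set
   below is nonempty and bounded. *)
Definition functional_norm (T : set E) (f : E -> R) : R :=
  sup [set `|f v| | v in [set v | T v /\ `|v| = 1]].

Definition dual_norm (f : E -> R) : R := functional_norm setT f.

(* Continuity of the derivative is meant for the norm of the dual of [E]. *)
Definition continuously_differentiable (phi : E -> R) : Prop :=
  (forall u : E, differentiable phi u) /\
  (forall u : E,
     dual_norm (fun w => 'd phi v w - 'd phi u w) @[v --> u] --> (0 : R)).

(* The inclusion of a Banach space [E] into [H] is an explicit map [i]. *)
Variables (ip : {dot H for idfun}) (i : {linear E -> H}).

(* The inclusion of [H] into the dual of [E], with [H] identified with its own
   dual. *)
Definition to_dual (h : H) : E -> R := fun v => ip h (i v).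

(* [E -> H] and [H -> E^*] are continuous injections, [E^*] having its norm
   topology. *)
Definition continuous_injections : Prop :=
  [/\ injective i, continuous i, injective to_dual &
      forall h : H,
        dual_norm (fun w => to_dual h' w - to_dual h w) @[h' --> h] --> (0 : R)].

Definition unit_sphere : set E := [set u | `|i u| = 1].

Definition tangent_space (u : E) : set E := [set v | ip (i u) (i v) = 0].

Definition constrained_derivative_norm (phi : E -> R) (u : E) : R :=
  functional_norm (tangent_space u) ('d phi u).

Definition enlargement (S : set E) (delta : R) : set E :=
  [set v | exists2 u, S u & `|u - v| < delta].

Definition sublevel (phi : E -> R) (b : R) : set E := [set u | phi u <= b].

End ConstrainedFunctional.

(* Main.v *)
Require Import Defs.
From HB Require Import structures.
From mathcomp Require Import all_boot all_order all_algebra sesquilinear.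
From mathcomp Require Import all_classical all_reals all_analysis.
From mathcomp Require Import wochoice ring lra.
Import Order.TTheory GRing.Theory Num.Theory.
Import numFieldNormedType.Exports.
Local Open Scope classical_set_scope.
Local Open Scope ring_scope.

(** The deformation is the time-one flow of a vector field on [E] that is
tangent to the sphere, vanishes off the region where the derivative bound is
assumed, and decreases [phi] at rate at least [2 * eps] on the part of that
region where decrease is required, while moving points at speed at most
[delta / 2]. A point of [S] then stays within [delta] of [S] up to time one, so
as long as its level is still above [a - eps] it keeps losing height at rate
[2 * eps], and in unit time it falls from [a + eps] to [a - eps].

The field. For [u] on the sphere the hypothesis gives a unit tangent vector
along which the derivative of [phi] exceeds [6 * eps / delta]. The conditions
defining [descent_direction u v] are open in [u] and those of them that involve
[v] are convex in [v]. It remains to select such a [v] in a locally Lipschitz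
way ([lipschitz_selection]). [E] may be nonseparable, so this is a form of the
paracompactness of metric spaces. Well-order the vectors. For each [n] there are
bump functions [f n v], Lipschitz and supported where [v] is admissible, such
that at each point at most one of them is nonzero; hence [sum_v f n v x *: v]
is Lipschitz in [x] ([disjoint_sum_lipschitz]). The weighted series over [n] is
Lipschitz again ([mesh_sum_cvg]), and dividing it by the total weight gives the
average of admissible vectors. Adding to the denominator a Lipschitz function
that vanishes exactly on the closed set where the average must be genuine makes
the quotient locally Lipschitz on the whole space: the cutoff comes for free.

Tangency. The field is [- (delta / 2) *: tangential u (Z u)] with [Z] the
selection and [tangential u v = (u,u) v - (u,v) u]. This is the orthogonal
projection when [u] is on the sphere, it is defined and locally Lipschitz on all
of [E], and it is orthogonal to [u] everywhere, so that [(u,u)] is constant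
along the flow and the sphere is invariant.

The flow. For a bounded locally Lipschitz field on a Banach space the Euler
polygons with step [2 ^- n] converge, jointly in [n] and in the initial point,
for every time [t >= 0]. Real induction on [t] reduces this to short times
([euler_limit_local]): the set of good times is closed since polygons
are Lipschitz in time up to one step, uniformly in the step, and it extends to the right since the polygon
started at a limit point converges for a while. Joint convergence contains both
the continuity of the flow and its semigroup law. Each time-[t] map is a
homeomorphism because the flow of the opposite field inverts it
([flow_reverse]). Growth estimates along orbits are again real inductions, from
the right derivative ([flow_growth]). *)

Set Implicit Arguments.
Unset Strict Implicit.
Unset Printing Implicit Defensive.

(** * Real induction and a discrete Gronwall inequality *)

Section Preliminaries.
Variable R : realType.

(** The supremum of the times up to which [P] holds is itself such a time, by the
third hypothesis, and cannot be finite, by the second. *)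
Lemma real_induction (P : R -> Prop) :
  P 0 ->
  (forall t, 0 <= t -> P t ->
     exists2 s0, 0 < s0 & forall s, 0 <= s -> s <= s0 -> P (t + s)) ->
  (forall t, 0 < t -> (forall s, 0 <= s -> s < t -> P s) -> P t) ->
  forall t, 0 <= t -> P t.
Proof.
move=> P0 Pstep Plim t t0; apply: contrapT => nPt.
pose A : set R := [set x | 0 <= x /\ forall s, 0 <= s -> s <= x -> P s].
have A0 : A 0 by split=> // s s0 s1; have -> : s = 0 by lra.
have Aub : ubound A t.
  by move=> x [x0 Px]; rewrite leNgt; apply/negP => tx; apply: nPt; apply: Px => //; lra.
have supA : has_sup A by split; [exists 0 | exists t].
have s0 : 0 <= sup A by apply: ub_le_sup => //; exists t.
have below s : 0 <= s -> s < sup A -> P s.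
  move=> s1 /(sup_gt supA.1)[x [x0 Px] sx].
  by apply: Px => //; exact: ltW.
have Psup : P (sup A).
  case: (eqVneq (sup A) 0) => [-> //|n0].
  by apply: Plim => //; rewrite lt_neqAle eq_sym n0.
have [e e0 Pe] := Pstep _ s0 Psup.
have : A (sup A + e).
  split; first lra.
  move=> s s1 s2; have [lt|ge] := ltP s (sup A); first exact: below.
  have -> : s = sup A + (s - sup A) by ring.
  by apply: Pe; lra.
by move/(ub_le_sup supA.2); lra.
Qed.

(** Over a total time [m * k] at most one half the growth factor [(1 + k) ^+ m]
is at most [1 + 2 * (m * k)], hence at most 2; this linear bound replaces the
exponential. *)
Lemma discrete_gronwall (a : nat -> R) (k e : R) (m : nat) :
  0 <= k -> 0 <= e -> 0 <= a 0%N ->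
  (forall j, (j < m)%N -> a j.+1 <= (1 + k) * a j + e) ->
  m%:R * k <= 2^-1 -> a m <= 2 * (a 0%N + m%:R * e).
Proof.
move=> k0 e0 a0 astep mk.
have h j : (j <= m)%N -> a j <= (1 + 2 * (j%:R * k)) * (a 0%N + j%:R * e).
  elim: j => [_|j IH jm]; first by rewrite !mul0r mulr0 !addr0 mul1r.
  apply: (le_trans (astep j jm)).
  have IHj := IH (ltnW jm).
  have jk : j%:R * k <= 2^-1.
    by apply: le_trans mk; apply: ler_wpM2r => //; rewrite ler_nat ltnW.
  have j0 : 0 <= j%:R :> R by [].
  have jk0 : 0 <= j%:R * k by apply: mulr_ge0.
  have je0 : 0 <= j%:R * e by apply: mulr_ge0.
  have -> : j.+1%:R * k = j%:R * k + k by rewrite -natr1 mulrDl mul1r.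
  have -> : j.+1%:R * e = j%:R * e + e by rewrite -natr1 mulrDl mul1r.
  move: IHj jk j0 jk0 je0; set A := a 0%N in a0 *; set J := (j%:R * k).
  set T := (j%:R * e) => IHj jk j0 jk0 je0.
  have h1 : (1 + k) * a j <= (1 + k) * ((1 + 2 * J) * (A + T)).
    by apply: ler_wpM2l => //; lra.
  have h2 : 0 <= k * (1 - 2 * J) * (A + T).
    by apply: mulr_ge0; [apply: mulr_ge0|]; lra.
  have h3 : 0 <= (J + k) * e by apply: mulr_ge0 => //; lra.
  lra.
apply: (le_trans (h m (leqnn m))); apply: ler_wpM2r; last by lra.
by apply: addr_ge0 => //; apply: mulr_ge0.
Qed.

Definition locally_lipschitz (V W : normedModType R) (f : V -> W) :=
  forall x, exists L r, [/\ 0 < L, 0 < r & forall y z,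
    `|x - y| < r -> `|x - z| < r -> `|f y - f z| <= L * `|y - z|].

Lemma cauchy_limit (V : completeNormedModType R) (u : nat -> V) :
  (forall e, 0 < e -> exists N, forall n m, (N <= n)%N -> (N <= m)%N ->
     `|u n - u m| < e) ->
  exists l, forall e, 0 < e -> exists N, forall n, (N <= n)%N -> `|u n - l| < e.
Proof.
move=> uc; have /cvg_ex[l ul] : cvgn u.
  apply/cauchy_cvgP/cauchy_exP => e e0; have [N uN] := uc e e0.
  exists (u N), N => // n /= Nn; rewrite -ball_normE /=; exact: uN.
exists l => e e0; have /cvgrPdist_lt/(_ e e0)[N _ uN] := ul.
by exists N => n /uN; rewrite distrC.
Qed.

End Preliminaries.

(** * Finite Euler schemes *)

Section EulerScheme.
Variables (R : realType) (E : completeNormedModType R).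
Variables (F : E -> E) (K : R).
Hypothesis FK : forall x, `|F x| <= K.

Definition euler_step (h : R) (x : E) : E := x + h *: F x.

Let K0 : 0 <= K. Proof. exact: le_trans (normr_ge0 _) (FK 0). Qed.

Lemma iter_euler_dist h m x : 0 <= h ->
  `|iter m (euler_step h) x - x| <= m%:R * h * K.
Proof.
move=> h0; elim: m => [|m IH]; first by rewrite subrr normr0 !mul0r.
rewrite iterS /euler_step -/(euler_step h) addrAC.
apply: (le_trans (ler_normD _ _)).
rewrite -natr1 !mulrDl mul1r lerD// normrZ ger0_norm//.
exact: ler_wpM2l.
Qed.

Section LocalScheme.
Variables (x0 : E) (r L : R).
Hypothesis L0 : 0 < L.
Hypothesis FL : forall y z, `|x0 - y| < r -> `|x0 - z| < r ->
  `|F y - F z| <= L * `|y - z|.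

(** Along the scheme the field varies by at most [L] times the distance
travelled, so the scheme agrees to second order with one long Euler step.
Everything known about the flow near time zero comes from this estimate. *)
Lemma iter_euler_expansion h m x : 0 <= h -> `|x0 - x| + m%:R * h * K < r ->
  `|iter m (euler_step h) x - x - (m%:R * h) *: F x| <= L * K * (m%:R * h) ^+ 2.
Proof.
move=> h0; elim: m => [|m IH] xr.
  by rewrite subrr !mul0r scale0r subrr normr0 expr0n mulr0.
have mh : 0 <= m%:R * h by apply: mulr_ge0.
have hK : 0 <= h * K by apply: mulr_ge0.
have mhK : 0 <= m%:R * h * K by apply: mulr_ge0.
have mS : m.+1%:R * h = m%:R * h + h by rewrite -natr1 mulrDl mul1r.
rewrite mS mulrDl in xr.
have {}IH := IH ltac:(lra).
have d := @iter_euler_dist h m x h0.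
rewrite iterS; set y := iter m _ x in IH d *.
have yr : `|x0 - y| < r.
  by have := ler_distD x x0 y; rewrite (distrC x y); lra.
rewrite mS /euler_step scalerDl.
have -> : y + h *: F y - x - ((m%:R * h) *: F x + h *: F x) =
  (y - x - (m%:R * h) *: F x) + h *: (F y - F x).
  by rewrite scalerBr opprD !addrA [LHS](ACl (1*3*4*2*5)).
apply: (le_trans (ler_normD _ _)); rewrite normrZ ger0_norm//.
have FL' := FL yr (_ : `|x0 - x| < r).
have {FL'} FL' := FL' ltac:(lra).
have h1 : h * `|F y - F x| <= h * (L * (m%:R * h * K)).
  by apply: ler_wpM2l => //; apply: (le_trans FL'); apply: ler_wpM2l => //; exact: ltW.
have h2 : 0 <= L * K * (h * (m%:R * h)) by rewrite !mulr_ge0// ltW.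
have h3 : 0 <= L * K * (h * h) by rewrite !mulr_ge0// ltW.
move: h2 h3 IH h1; set p := m%:R * h; set n1 := `|_|; set n2 := `|_| => *.
have -> : L * K * (p + h) ^+ 2 = L * K * p ^+ 2 + 2 * (L * K * (h * p)) + L * K * (h * h) by ring.
lra.
Qed.

(** Stability of the scheme. It is used with one sequence being a finer scheme
sampled at the coarse step (convergence), and with one being a scheme run
backwards (inversion). *)
Lemma approx_euler_dist h e m (z w : nat -> E) : 0 <= h -> 0 <= e ->
  (forall j, (j < m)%N -> `|x0 - z j| < r) ->
  (forall j, (j < m)%N -> `|x0 - w j| < r) ->
  (forall j, (j < m)%N -> `|z j.+1 - euler_step h (z j)| <= e) ->
  (forall j, (j < m)%N -> `|w j.+1 - euler_step h (w j)| <= e) ->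
  m%:R * (h * L) <= 2^-1 ->
  `|z m - w m| <= 2 * (`|z 0%N - w 0%N| + m%:R * (2 * e)).
Proof.
move=> h0 e0 zr wr ze we mhL.
apply: (@discrete_gronwall _ (fun j => `|z j - w j|) (h * L)) => //.
- by apply: mulr_ge0 => //; exact: ltW.
- lra.
move=> j jm.
have s1 : `|euler_step h (z j) - euler_step h (w j)| <= (1 + h * L) * `|z j - w j|.
  rewrite /euler_step opprD addrACA -scalerBr (le_trans (ler_normD _ _))//.
  rewrite mulrDl mul1r lerD// normrZ ger0_norm// -mulrA ler_wpM2l//.
  by apply: FL; [exact: zr | exact: wr].
have s2 := ler_distD (euler_step h (z j)) (z j.+1) (w j.+1).
have s3 := ler_distD (euler_step h (w j)) (euler_step h (z j)) (w j.+1).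
have := ze j jm; have := we j jm; rewrite (distrC (w _)); lra.
Qed.

End LocalScheme.
End EulerScheme.

Section Mesh.
Variable R : realType.

Definition mesh (n : nat) : R := 2^-1 ^+ n.

Lemma mesh_gt0 n : 0 < mesh n.
Proof. by rewrite exprn_gt0. Qed.

Lemma meshS n : mesh n.+1 = mesh n / 2 :> R.
Proof. by rewrite /mesh exprS mulrC. Qed.

Lemma mesh_split m n : (m <= n)%N -> (2 ^ (n - m))%:R * mesh n = mesh m.
Proof.
move=> mn; rewrite natrX /mesh -{2}(subnKC mn) exprD mulrCA -exprMn mulfV//.
by rewrite expr1n mulr1.
Qed.

Lemma mesh_le m n : (m <= n)%N -> mesh n <= mesh m.
Proof. by move=> mn; apply: ler_wiXn2l => //; lra. Qed.

Lemma mesh_small e : 0 < e -> exists N, forall n, (N <= n)%N -> mesh n < e.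
Proof.
move=> e0; have : (mesh n @[n --> \oo] --> (0 : R)).
  by apply: cvg_expr; rewrite ger0_norm ?invr_ge0// invf_lt1// ltr1n.
move=> /cvgrPdist_lt/(_ e e0)[N _ HN]; exists N => n /HN.
by rewrite sub0r normrN gtr0_norm// mesh_gt0.
Qed.

Lemma truncn_mesh t n (k := Num.truncn (t * 2 ^+ n)) : 0 <= t ->
  k%:R * mesh n <= t < k%:R * mesh n + mesh n.
Proof.
move=> t0; have /truncn_itv/andP[] : 0 <= t * 2 ^+ n by rewrite mulr_ge0 ?exprn_ge0.
rewrite -/k => h1 h2; have e : 2 ^+ n * mesh n = 1.
  by rewrite /mesh -exprMn mulfV// expr1n.
move: h1; rewrite -(ler_pM2r (mesh_gt0 n)) -mulrA e mulr1 => ->/=.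
by move: h2; rewrite -(ltr_pM2r (mesh_gt0 n)) -mulrA e mulr1 -natr1 mulrDl mul1r.
Qed.

Lemma le_truncn_scale s t n : s <= t ->
  (Num.truncn (s * 2 ^+ n : R) <= Num.truncn (t * 2 ^+ n : R))%N.
Proof. by move=> st; apply: le_truncn; rewrite ler_wpM2r// exprn_ge0. Qed.

(** Integer parts are compared through this lemma: [k < l + 1] is read off from
inequalities between the times [k * mesh n] and [l * mesh n]. *)
Lemma leq_of_mesh n (k l : nat) : k%:R * mesh n < l%:R * mesh n + mesh n ->
  (k <= l)%N.
Proof.
have -> : l%:R * mesh n + mesh n = l.+1%:R * mesh n by rewrite -natr1 mulrDl mul1r.
by rewrite ltr_pM2r ?mesh_gt0// ltr_nat.
Qed.

End Mesh.
Arguments mesh {R} n.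
#[global] Hint Extern 0 (is_true (0 < mesh _)) => exact: mesh_gt0 : core.

Section EulerPolygon.
Variables (R : realType) (E : completeNormedModType R).
Variables (F : E -> E) (K : R).
Hypothesis FK : forall x, `|F x| <= K.
Let K0 : 0 <= K. Proof. exact: le_trans (normr_ge0 _) (FK 0). Qed.

(** The polygon is evaluated at the last grid time before [t], with no
interpolation; this costs at most one step, of length [mesh n * K]. *)
Definition euler_polygon (n : nat) (t : R) (x : E) : E :=
  iter (Num.truncn (t * 2 ^+ n)) (euler_step F (mesh n)) x.

Lemma euler_polygon0 n x : euler_polygon n 0 x = x.
Proof. by rewrite /euler_polygon mul0r truncn0. Qed.

Lemma euler_polygon_fixed n t x : F x = 0 -> euler_polygon n t x = x.
Proof.
move=> Fx; rewrite /euler_polygon; elim: (Num.truncn _) => //= k ->.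
by rewrite /euler_step Fx scaler0 addr0.
Qed.

Lemma euler_polygon_time n s t x : 0 <= s -> s <= t ->
  `|euler_polygon n t x - euler_polygon n s x| <= K * (t - s + mesh n).
Proof.
move=> s0 st; rewrite /euler_polygon.
have /andP[s1 s2] := truncn_mesh n s0.
have /andP[t1 t2] := truncn_mesh n (le_trans s0 st).
have kst := le_truncn_scale n st.
set k := Num.truncn (s * _) in s1 s2 kst *.
set l := Num.truncn (t * _) in t1 t2 kst *.
have h1 := iter_euler_dist FK (l - k) (iter k (euler_step F (mesh n)) x) (ltW (@mesh_gt0 R n)).
rewrite -iterD subnK// natrB// mulrBl in h1.
by apply: (le_trans h1); rewrite mulrC ler_wpM2l//; lra.
Qed.

(** The integer parts of two scaled times add up to that of the sum, up to one;
so the semigroup law fails by at most one step. *)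
Lemma euler_polygonD n s t x : 0 <= s -> 0 <= t ->
  `|euler_polygon n (t + s) x - euler_polygon n s (euler_polygon n t x)| <= mesh n * K.
Proof.
move=> s0 t0; rewrite /euler_polygon -iterD.
have /andP[s1 s2] := truncn_mesh n s0.
have /andP[t1 t2] := truncn_mesh n t0.
have /andP[u1 u2] := truncn_mesh n (addr_ge0 t0 s0).
move: s1 s2 t1 t2 u1 u2.
set k := Num.truncn (s * _); set l := Num.truncn (t * _); set m := Num.truncn _.
move=> s1 s2 t1 t2 u1 u2.
have kl : (k + l <= m)%N by apply: (@leq_of_mesh R n); rewrite natrD mulrDl; lra.
have h1 := iter_euler_dist FK (m - (k + l)) (iter (k + l) (euler_step F (mesh n)) x) (ltW (@mesh_gt0 R n)).
rewrite -iterD subnK// in h1.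
apply: (le_trans h1); apply: ler_wpM2r => //.
rewrite ger_pMl// lern1 leq_subLR addn1.
by apply: (@leq_of_mesh R n); rewrite -natr1 natrD !mulrDl mul1r; lra.
Qed.

Section LocalPolygon.
Variables (x0 : E) (r L : R).
Hypothesis L0 : 0 < L.
Hypothesis FL : forall y z, `|x0 - y| < r -> `|x0 - z| < r ->
  `|F y - F z| <= L * `|y - z|.

Lemma euler_polygon_expansion n s y : 0 <= s -> `|x0 - y| + s * K < r ->
  `|euler_polygon n s y - y - s *: F y| <= L * K * s ^+ 2 + mesh n * K.
Proof.
move=> s0 yr; have /andP[s1 s2] := truncn_mesh n s0.
rewrite /euler_polygon; set k := Num.truncn _ in s1 s2 *.
have ks : k%:R * mesh n * K <= s * K by exact: ler_wpM2r.
have := iter_euler_expansion FK L0 FL (ltW (@mesh_gt0 R n)) (_ : `|x0 - y| + k%:R * mesh n * K < r).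
move=> /(_ ltac:(lra)); set z := iter _ _ _ => hz.
set p := k%:R * _ in s1 s2 ks hz *.
have -> : z - y - s *: F y = (z - y - p *: F y) - (s - p) *: F y.
  by rewrite scalerBl opprB addrA subrK.
apply: (le_trans (ler_normB _ _)); rewrite normrZ ger0_norm; last lra.
apply: lerD; last by apply: ler_pM => //; lra.
apply: (le_trans hz); apply: ler_wpM2l; first by rewrite mulr_ge0// ltW.
by rewrite lerXn2r// ?nnegrE// mulr_ge0// ltW.
Qed.

(** A block of [2 ^ (n - m)] fine steps is a coarse step up to a second-order
error, by [iter_euler_expansion]; stability then bounds the accumulated error by
a multiple of the coarse mesh. *)
Lemma euler_polygon_refine m n s y y' : (m <= n)%N -> 0 <= s -> s * L <= 2^-1 ->
  `|x0 - y| + s * K + mesh m * K < r -> `|x0 - y'| + s * K + mesh m * K < r ->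
  `|euler_polygon n s y - euler_polygon m s y'|
    <= 2 * `|y - y'| + 3 * (mesh m * K).
Proof.
move=> mn s0 sL yr yr'.
have mK : 0 <= mesh m * K by rewrite mulr_ge0// ltW.
have /andP[s1 s2] := truncn_mesh m s0; have /andP[s3 s4] := truncn_mesh n s0.
rewrite /euler_polygon; move: s1 s2 s3 s4.
set k := Num.truncn _; set l := Num.truncn _ => s1 s2 s3 s4.
pose q := (2 ^ (n - m))%N.
have qn : q%:R * mesh n = mesh m :> R by exact: mesh_split.
have kql : (k * q <= l)%N.
  by apply: (@leq_of_mesh R n); rewrite natrM -mulrA qn; lra.
pose z j := iter (j * q) (euler_step F (mesh n)) y.
pose w j := iter j (euler_step F (mesh m)) y'.
have jK j : (j <= k)%N -> j%:R * mesh m * K <= s * K.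
  move=> jk; apply: ler_wpM2r => //; apply: le_trans s1.
  by apply: ler_wpM2r; [exact: ltW | rewrite ler_nat].
have zr j : (j <= k)%N -> `|x0 - z j| <= `|x0 - y| + s * K.
  move=> /jK h; have := iter_euler_dist FK (j * q) y (ltW (@mesh_gt0 R n)).
  rewrite natrM -(mulrA j%:R) qn -/(z j) => h2.
  by have := ler_distD y x0 (z j); rewrite (distrC y); lra.
have wr j : (j <= k)%N -> `|x0 - w j| <= `|x0 - y'| + s * K.
  move=> /jK h; have := iter_euler_dist FK j y' (ltW (@mesh_gt0 R m)).
  rewrite -/(w j) => h2.
  by have := ler_distD y' x0 (w j); rewrite (distrC y'); lra.
have e0 : 0 <= L * K * mesh m ^+ 2 by rewrite !mulr_ge0// ?exprn_ge0// ltW.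
have := @approx_euler_dist _ _ F x0 r L L0 FL (mesh m) (L * K * mesh m ^+ 2) k z w (ltW (@mesh_gt0 R m)) e0.
have h1 j : (j < k)%N -> `|x0 - z j| < r by move=> /ltnW/zr; lra.
have h2 j : (j < k)%N -> `|x0 - w j| < r by move=> /ltnW/wr; lra.
have h3 j : (j < k)%N ->
    `|z j.+1 - euler_step F (mesh m) (z j)| <= L * K * mesh m ^+ 2.
  move=> jk; rewrite /euler_step opprD addrA /z mulSn iterD -qn -/(z j).
  apply: (iter_euler_expansion FK L0 FL); first exact: ltW.
  by rewrite qn; have := zr j (ltnW jk); lra.
have h4 j : (j < k)%N ->
    `|w j.+1 - euler_step F (mesh m) (w j)| <= L * K * mesh m ^+ 2.
  by move=> jk; rewrite /w iterS subrr normr0.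
have h5 : k%:R * (mesh m * L) <= 2^-1.
  by rewrite mulrA (le_trans _ sL)// ler_wpM2r// ltW.
move=> /(_ h1 h2 h3 h4 h5); rewrite {2}/z {2}/w /= => zw.
have := iter_euler_dist FK (l - k * q) (z k) (ltW (@mesh_gt0 R n)).
rewrite -iterD subnK//; set p := iter l _ _ => pz.
have pz2 : `|p - z k| <= mesh m * K.
  apply: (le_trans pz); apply: ler_wpM2r => //.
  by rewrite natrB// mulrBl natrM -mulrA qn; lra.
have h6 : k%:R * (L * K * mesh m ^+ 2) <= 2^-1 * (mesh m * K).
  have -> : k%:R * (L * K * mesh m ^+ 2) = k%:R * (mesh m * L) * (mesh m * K) by ring.
  exact: ler_wpM2r.
have := ler_distD (z k) p (w k); rewrite -/(w k); lra.
Qed.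

End LocalPolygon.

End EulerPolygon.

(** * The flow of a bounded locally Lipschitz field *)

Section Flow.
Variables (R : realType) (E : completeNormedModType R).
Implicit Types (F : E -> E) (K t s : R) (x y l : E).

(** The convergence is joint in the mesh and in the starting point: this makes
limits composable ([euler_limitD]) and continuous in the starting point. *)
Definition euler_limit F t x l := forall e, 0 < e -> exists N d, 0 < d /\
  forall n y, (N <= n)%N -> `|x - y| < d -> `|euler_polygon F n t y - l| < e.

Definition flow F t x : E := xget 0 [set l | euler_limit F t x l].

Lemma euler_limit_unique F t x l l' :
  euler_limit F t x l -> euler_limit F t x l' -> l = l'.
Proof.
move=> h h'; apply/eqP; rewrite -subr_eq0 -normr_eq0; apply/negPn/negP => n0.
have e0 : 0 < `|l - l'| / 2 by rewrite divr_gt0// lt_def n0 normr_ge0.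
have [N [d [d0 hN]]] := h _ e0; have [N' [d' [d'0 hN']]] := h' _ e0.
have := hN (maxn N N') x (leq_maxl _ _); rewrite subrr normr0 => /(_ d0).
have := hN' (maxn N N') x (leq_maxr _ _); rewrite subrr normr0 => /(_ d'0).
have := ler_distD (euler_polygon F (maxn N N') t x) l l'.
rewrite (distrC l (euler_polygon _ _ _ _)); lra.
Qed.

Lemma euler_limit_cauchy F t x :
  (forall e, 0 < e -> exists N d, 0 < d /\ forall m n y y', (N <= m)%N -> (m <= n)%N ->
     `|x - y| < d -> `|x - y'| < d ->
     `|euler_polygon F n t y - euler_polygon F m t y'| < e) ->
  exists l, euler_limit F t x l.
Proof.
move=> h; have [] := @cauchy_limit R E (fun n => euler_polygon F n t x).
  move=> e e0; have [N [d [d0 hN]]] := h e e0; exists N => n m Nn Nm.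
  have xx : `|x - x| < d by rewrite subrr normr0.
  case/orP: (leq_total m n) => mn; first exact: hN.
  by rewrite distrC; exact: hN.
move=> l hl; exists l => e e0.
have e20 : 0 < e / 2 by rewrite divr_gt0.
have [N [d [d0 hN]]] := h _ e20; have [M hM] := hl _ e20.
exists (maxn N M), d; split=> // n y nNM xy.
have h1 := hN (maxn N M) n y x (leq_maxl _ _) nNM xy; rewrite subrr normr0 in h1.
have := hM _ (leq_maxr N M); have := h1 d0.
have := ler_distD (euler_polygon F (maxn N M) t x) (euler_polygon F n t y) l.
lra.
Qed.

Section Bounded.
Variables (F : E -> E) (K : R).
Hypotheses (K_gt0 : 0 < K) (FK : forall x, `|F x| <= K).

Lemma meshK_small (e : R) : 0 < e ->
  exists N, forall n, (N <= n)%N -> mesh n * K < e.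
Proof.
move=> e0; have [N hN] := @mesh_small R (e / K) (divr_gt0 e0 K_gt0).
by exists N => n /hN; rewrite ltr_pdivlMr.
Qed.

Lemma euler_limit0 x : euler_limit F 0 x x.
Proof. by move=> e e0; exists 0%N, e; split=> // n y _; rewrite euler_polygon0 distrC. Qed.

Lemma euler_limitD s t x l l' : 0 <= s -> 0 <= t ->
  euler_limit F t x l -> euler_limit F s l l' -> euler_limit F (t + s) x l'.
Proof.
move=> s0 t0 h h' e e0.
have e20 : 0 < e / 2 by rewrite divr_gt0.
have [N' [d' [d'0 hN']]] := h' _ e20; have [N [d [d0 hN]]] := h _ d'0.
have [M hM] := meshK_small e20.
exists (maxn M (maxn N N')), d; split=> // n y; rewrite !geq_max => /and3P[Mn Nn N'n] xy.
have := hN n y Nn xy; rewrite distrC => /(hN' n _ N'n).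
have := euler_polygonD FK n y s0 t0; have := hM n Mn.
have := ler_distD (euler_polygon F n s (euler_polygon F n t y)) (euler_polygon F n (t + s) y) l'.
lra.
Qed.

Lemma euler_limit_time s t x l l' : 0 <= s -> s <= t ->
  euler_limit F t x l -> euler_limit F s x l' -> `|l - l'| <= K * (t - s).
Proof.
move=> s0 st h h'; apply/ler_addgt0Pr => e e0.
have e30 : 0 < e / 3 by rewrite divr_gt0.
have [N [d [d0 hN]]] := h _ e30; have [N' [d' [d'0 hN']]] := h' _ e30.
have [M hM] := meshK_small e30.
pose n := maxn M (maxn N N').
have : (n <= n)%N by []; rewrite {1}/n !geq_max => /and3P[Mn Nn N'n].
have := hN n x Nn; rewrite subrr normr0 => /(_ d0).
have := hN' n x N'n; rewrite subrr normr0 => /(_ d'0).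
have := euler_polygon_time FK n x s0 st; have := hM n Mn.
have := ler_distD (euler_polygon F n t x) l l'.
have := ler_distD (euler_polygon F n s x) (euler_polygon F n t x) l'.
rewrite (distrC l (euler_polygon _ _ _ _)) mulrDr (mulrC (mesh n)); lra.
Qed.

(** Polygons move at speed at most [K], so a time slightly before [t] controls
time [t] up to an arbitrarily small error. *)
Lemma euler_limit_closed t x : 0 < t ->
  (forall s, 0 <= s -> s < t -> exists l, euler_limit F s x l) ->
  exists l, euler_limit F t x l.
Proof.
move=> t0 h; apply: euler_limit_cauchy => e e0.
have e60 : 0 < e / 6 by rewrite divr_gt0.
pose c := Num.min t (e / 6 / K).
have c0 : 0 < c by rewrite lt_min t0 divr_gt0.
have ct : c <= t by rewrite ge_min lexx.
have cK : K * c <= e / 6.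
  have : c <= e / 6 / K by rewrite ge_min lexx orbT.
  by rewrite ler_pdivlMr// mulrC.
have s0 : 0 <= t - c by lra.
have [//|l hl] := h (t - c) s0; first by lra.
have [N [d [d0 hN]]] := hl _ e60; have [M hM] := meshK_small e60.
exists (maxn M N), d; split=> // m n y y' Mm mn xy xy'.
have Mn := leq_trans Mm mn; move: Mm Mn; rewrite !geq_max => /andP[Mm Nm] /andP[Mn Nn].
have := hN n y Nn xy; have := hN m y' Nm xy'; have := hM m Mm; have := hM n Mn.
have st : t - c <= t by lra.
have := euler_polygon_time FK n y s0 st; have := euler_polygon_time FK m y' s0 st.
have -> : t - (t - c) = c by ring.
rewrite !mulrDr !(mulrC K (mesh _)).
have := ler_distD l (euler_polygon F n (t - c) y) (euler_polygon F m (t - c) y').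
have := ler_distD (euler_polygon F n (t - c) y) (euler_polygon F n t y) (euler_polygon F m t y').
have := ler_distD (euler_polygon F m (t - c) y') (euler_polygon F n (t - c) y) (euler_polygon F m t y').
rewrite (distrC l) (distrC (euler_polygon F m (t - c) y') (euler_polygon F m t y')).
lra.
Qed.

End Bounded.
End Flow.

Section FlowProperties.
Variables (R : realType) (E : completeNormedModType R).
Implicit Types (K t s : R) (x y l : E).

Section Forward.
Variables (F : E -> E) (K : R).
Hypotheses (K_gt0 : 0 < K) (FK : forall x, `|F x| <= K).
Hypothesis Flip : locally_lipschitz F.

(** For short times the polygons that start near [x] remain in a ball where the
field is Lipschitz. The second-order bound is uniform in the starting point and
passes to the limit. *)
Lemma euler_limit_local x : exists s0 C d, [/\ 0 < s0, 0 < C, 0 < d,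
  forall s, 0 <= s -> s <= s0 -> exists l, euler_limit F s x l &
  forall y s l, `|x - y| < d -> 0 <= s -> s <= s0 -> euler_limit F s y l ->
    `|l - y - s *: F y| <= C * s ^+ 2].
Proof.
have [L [r [L0 r0 FL]]] := Flip x.
pose s0 := Num.min (2^-1 / L) (r / 4 / K).
have s00 : 0 < s0 by rewrite lt_min !divr_gt0.
have sb s : s <= s0 -> s * L <= 2^-1 /\ s * K <= r / 4.
  by rewrite le_min !ler_pdivlMr// => /andP[].
have r40 : 0 < r / 4 by rewrite divr_gt0.
exists s0, (L * K), (r / 4); split=> //; first exact: mulr_gt0.
- move=> s s1 /sb[sL sK]; apply: euler_limit_cauchy => e e0.
  have [|N hN] := @meshK_small R K K_gt0 (Num.min (r / 4) (e / 6)).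
    by rewrite lt_min !divr_gt0.
  exists N, (Num.min (r / 4) (e / 8)); split; first by rewrite lt_min !divr_gt0.
  move=> m n y y' /hN; rewrite lt_min => /andP[m1 m2] mn.
  rewrite !lt_min => /andP[y1 y2] /andP[y1' y2'].
  have h1 : `|x - y| + s * K + mesh m * K < r by lra.
  have h2 : `|x - y'| + s * K + mesh m * K < r by lra.
  have := euler_polygon_refine FK L0 FL mn s1 sL h1 h2.
  by have := ler_distD x y y'; rewrite (distrC y x); lra.
- move=> y s l xy s1 /sb[sL sK] yl; apply/ler_addgt0Pr => e e0.
  have e20 : 0 < e / 2 by rewrite divr_gt0.
  have [N hN] := @meshK_small R K K_gt0 _ e20.
  have [M [d [d0 hM]]] := yl _ e20.
  pose n := maxn N M.
  have := hM n y (leq_maxr _ _); rewrite subrr normr0 => /(_ d0).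
  have := hN n (leq_maxl _ _).
  have h1 : `|x - y| + s * K < r by lra.
  have := euler_polygon_expansion FK L0 FL n s1 h1.
  set p := euler_polygon _ _ _ _.
  have -> : l - y - s *: F y = (l - p) + (p - y - s *: F y) by rewrite !addrA subrK.
  by have := ler_normD (l - p) (p - y - s *: F y); rewrite (distrC l p); lra.
Qed.

Lemma euler_limit_exists t x : 0 <= t -> exists l, euler_limit F t x l.
Proof.
move=> t0; apply: (@real_induction R (fun t => exists l, euler_limit F t x l)) t0.
- by exists x; exact: euler_limit0.
- move=> u u0 [l xl]; have [s0 [_ [_ [s00 _ _ h _]]]] := euler_limit_local l.
  exists s0 => // s s1 /(h s s1)[l' ll']; exists l'.
  exact: (euler_limitD K_gt0 FK s1 u0 xl ll').
- by move=> u u0 h; exact: (euler_limit_closed K_gt0 FK).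
Qed.

Lemma flowP t x : 0 <= t -> euler_limit F t x (flow F t x).
Proof.
move=> /euler_limit_exists-/(_ x)[l xl].
by rewrite /flow; case: xgetP => [_ -> //|/(_ l)].
Qed.

Lemma flowE t x l : 0 <= t -> euler_limit F t x l -> flow F t x = l.
Proof. by move=> t0; apply: euler_limit_unique; exact: flowP. Qed.

Lemma flow0 x : flow F 0 x = x.
Proof. by apply: flowE => //; exact: euler_limit0. Qed.

Lemma flowD t s x : 0 <= t -> 0 <= s -> flow F (t + s) x = flow F s (flow F t x).
Proof.
move=> t0 s0; apply: flowE; first exact: addr_ge0.
by apply: (euler_limitD K_gt0 FK s0 t0); exact: flowP.
Qed.

Lemma flow_time s t x : 0 <= s -> s <= t ->
  `|flow F t x - flow F s x| <= K * (t - s).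
Proof.
move=> s0 st; apply: (euler_limit_time K_gt0 FK s0 st); apply: flowP => //.
exact: le_trans st.
Qed.

Lemma flow_dist t x : 0 <= t -> `|flow F t x - x| <= K * t.
Proof. by move=> t0; have := flow_time x (lexx 0) t0; rewrite flow0 subr0. Qed.

Lemma flow_continuous t x e : 0 <= t -> 0 < e ->
  exists2 d, 0 < d & forall y, `|x - y| < d -> `|flow F t x - flow F t y| < e.
Proof.
move=> t0 e0; have e20 : 0 < e / 2 by rewrite divr_gt0.
have [N [d [d0 hN]]] := flowP x t0 e20; exists d => // y xy.
have [M [d' [d'0 hM]]] := flowP y t0 e20.
pose n := maxn N M.
have := hM n y (leq_maxr _ _); rewrite subrr normr0 => /(_ d'0).
have := hN n y (leq_maxl _ _) xy.
have := ler_distD (euler_polygon F n t y) (flow F t x) (flow F t y).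
rewrite (distrC (flow F t x) (euler_polygon _ _ _ _)); lra.
Qed.

Lemma flow_expansion x : exists s0 C, [/\ 0 < s0, 0 < C &
  forall s, 0 <= s -> s <= s0 -> `|flow F s x - x - s *: F x| <= C * s ^+ 2].
Proof.
have [s0 [C [d [s00 C0 d0 _ h]]]] := euler_limit_local x.
exists s0, C; split=> // s s1 s2; apply: h => //; first by rewrite subrr normr0.
exact: flowP.
Qed.

Lemma flow_fixed t x : 0 <= t -> F x = 0 -> flow F t x = x.
Proof.
move=> t0 Fx; apply/eqP; rewrite -subr_eq0 -normr_le0; apply/ler_addgt0Pr => e e0.
have [N [d [d0 hN]]] := flowP x t0 e0.
have := hN N x (leqnn _); rewrite subrr normr0 => /(_ d0).
by rewrite (euler_polygon_fixed _ _ Fx) add0r distrC => /ltW.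
Qed.

End Forward.

Section Reversal.
Variables (F : E -> E) (K : R).
Hypotheses (K_gt0 : 0 < K) (FK : forall x, `|F x| <= K).
Hypothesis Flip : locally_lipschitz F.
Let G x := - F x.
Let GK x : `|G x| <= K. Proof. by rewrite normrN. Qed.
Let Glip : locally_lipschitz G.
Proof.
move=> x; have [L [r [L0 r0 h]]] := Flip x; exists L, r; split=> // y z xy xz.
by rewrite -opprD normrN; exact: h.
Qed.

(** A backward Euler step undoes a forward one up to [L * K * mesh n ^+ 2], since
the field is evaluated at the other end of the step. Summed over the polygon,
this is of the order of the mesh and vanishes in the limit. *)
Lemma flow_reverse_local x : exists2 s0, 0 < s0 & forall s, 0 <= s -> s <= s0 ->
  flow G s (flow F s x) = x.
Proof.
have [L [r [L0 r0 FL]]] := Flip x.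
have GL y z : `|x - y| < r -> `|x - z| < r -> `|G y - G z| <= L * `|y - z|.
  by move=> xy xz; rewrite -opprD normrN; exact: FL.
pose s0 := Num.min (2^-1 / L) (r / 4 / K).
have s00 : 0 < s0 by rewrite lt_min !divr_gt0.
have sb s : s <= s0 -> s * L <= 2^-1 /\ s * K <= r / 4.
  by rewrite le_min !ler_pdivlMr// => /andP[].
exists s0 => // s s1 /sb[sL sK].
have approx n : `|euler_polygon G n s (euler_polygon F n s x) - x| <= 2 * (mesh n * K).
  have /andP[k1 k2] := truncn_mesh n s1.
  rewrite /euler_polygon; set k := Num.truncn _ in k1 k2 *.
  pose w j := iter j (euler_step F (mesh n)) x.
  pose z j := iter j (euler_step G (mesh n)) (w k).
  have h0 : 0 <= mesh n :> R by exact: ltW.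
  have jK j : (j <= k)%N -> j%:R * mesh n * K <= r / 4.
    move=> jk; apply: le_trans sK; apply: ler_wpM2r; first exact: ltW.
    by apply: le_trans k1; rewrite ler_wpM2r// ler_nat.
  have wx j : (j <= k)%N -> `|x - w j| <= r / 4.
    by move=> /jK; have := iter_euler_dist FK j x h0; rewrite distrC; exact: le_trans.
  have zx j : (j <= k)%N -> `|x - z j| <= r / 2.
    move=> jk; have := iter_euler_dist GK j (w k) h0.
    have := ler_distD (w k) x (z j); have := wx _ (leqnn k).
    by rewrite (distrC (w k)) -/(z j); have := jK _ jk; lra.
  have h1 j : (j < k)%N -> `|x - z j| < r by move=> /ltnW/zx; lra.
  have h2 j : (j < k)%N -> `|x - w (k - j)%N| < r by move=> _; have := wx _ (leq_subr j k); lra.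
  have e0 : 0 <= mesh n * (L * (mesh n * K)).
    by rewrite !mulr_ge0// ltW.
  have h3 j : (j < k)%N -> `|z j.+1 - euler_step G (mesh n) (z j)| <= mesh n * (L * (mesh n * K)).
    by move=> _; rewrite /z iterS subrr normr0.
  have h4 j : (j < k)%N -> `|w (k - j.+1)%N - euler_step G (mesh n) (w (k - j)%N)| <= mesh n * (L * (mesh n * K)).
    move=> jk; have -> : (k - j = (k - j.+1).+1)%N by rewrite subnS prednK// subn_gt0.
    have ik : ((k - j.+1).+1 <= k)%N by rewrite subnS prednK ?subn_gt0// leq_subr.
    move: (k - j.+1)%N ik => i ik.
    have -> : w i - euler_step G (mesh n) (w i.+1) = mesh n *: (F (w i.+1) - F (w i)).
      have wS : w i.+1 = w i + mesh n *: F (w i) by [].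
      rewrite /euler_step /G scalerN {1}wS.
      by rewrite scalerBr opprB addrCA opprD (addrA (w i)) subrr add0r.
    rewrite normrZ ger0_norm// ler_wpM2l//.
    have wi : `|x - w i| < r by have := wx _ (ltnW ik); lra.
    have wiS : `|x - w i.+1| < r by have := wx _ ik; lra.
    apply: (le_trans (FL _ _ wiS wi)); rewrite ler_wpM2l//; first exact: ltW.
    by have := iter_euler_dist FK 1 (w i) h0; rewrite mul1r.
  have h5 : k%:R * (mesh n * L) <= 2^-1.
    by rewrite mulrA (le_trans _ sL)// ler_wpM2r// ltW.
  have := @approx_euler_dist _ _ G x r L L0 GL (mesh n) _ k z (fun j => w (k - j)%N) h0 e0 h1 h2 h3 h4 h5.
  have z0 : z 0%N = w k by [].
  have w0 : w 0%N = x by [].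
  rewrite subnn subn0 z0 w0 subrr normr0 add0r.
  have : k%:R * (mesh n * L) * (mesh n * K) <= 2^-1 * (mesh n * K).
    by rewrite ler_wpM2r// mulr_ge0// ltW.
  rewrite -/(w k) -/(z k); lra.
apply/eqP; rewrite -subr_eq0 -normr_le0; apply/ler_addgt0Pr => e e0.
have e20 : 0 < e / 2 by rewrite divr_gt0.
have e40 : 0 < e / 4 by rewrite divr_gt0.
have [N [d [d0 hN]]] := flowP K_gt0 GK Glip (flow F s x) s1 e20.
have [M [d' [d'0 hM]]] := flowP K_gt0 FK Flip x s1 d0.
have [P hP] := @meshK_small R K K_gt0 _ e40.
pose n := maxn P (maxn N M).
have : (n <= n)%N by []; rewrite {1}/n !geq_max => /and3P[Pn Nn Mn].
have := hM n x Mn; rewrite subrr normr0 distrC => /(_ d'0)/(hN n _ Nn).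
have := hP n Pn; have := approx n.
set p := euler_polygon _ _ _ _.
have := ler_distD p (flow G s (flow F s x)) x.
rewrite (distrC _ p); lra.
Qed.

(** By the semigroup law of both flows, a short piece of orbit added at the end
is cancelled first; this is the inductive step. *)
Lemma flow_reverse t x : 0 <= t -> flow G t (flow F t x) = x.
Proof.
move=> t0; apply: (@real_induction R (fun t => flow G t (flow F t x) = x)) t0.
- by rewrite (flow0 K_gt0 FK)// (flow0 K_gt0 GK).
- move=> u u0 IH; have [s0 s00 h] := flow_reverse_local (flow F u x).
  exists s0 => // s s1 s2.
  by rewrite (flowD K_gt0 FK)// addrC (flowD K_gt0 GK)// h.
move=> {}t {}t0 h; apply/eqP; rewrite -subr_eq0 -normr_le0; apply/ler_addgt0Pr => e e0.
have e20 : 0 < e / 2 by rewrite divr_gt0.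
have [d d0 hd] := flow_continuous K_gt0 GK Glip (flow F t x) (ltW t0) e20.
pose c := Num.min t (Num.min (e / 2 / K) (d / 2 / K)).
have c0 : 0 < c by rewrite !lt_min t0 !divr_gt0.
have : c <= c by []; rewrite {2}/c !le_min !ler_pdivlMr// => /and3P[ct ce cd].
have s0 : 0 <= t - c by lra.
have st : t - c <= t by lra.
have := flow_time K_gt0 FK Flip x s0 st.
have := flow_time K_gt0 GK Glip (flow F (t - c) x) s0 st.
have -> : t - (t - c) = c by ring.
rewrite h//; last lra.
move=> h1 h2; have /hd h3 : `|flow F t x - flow F (t - c) x| < d by lra.
have := ler_distD (flow G t (flow F (t - c) x)) (flow G t (flow F t x)) x; lra.
Qed.

End Reversal.
End FlowProperties.

(** * Growth of functions along the flow *)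

Section Lyapunov.
Variables (R : realType) (E : completeNormedModType R).
Implicit Types (K c t s : R) (x y : E).
Variables (F : E -> E) (K : R).
Hypotheses (K_gt0 : 0 < K) (FK : forall x, `|F x| <= K).
Hypothesis Flip : locally_lipschitz F.

(** The hypothesis bounds the upper right derivative of [f] along the orbit by
[c]. The slack [e] keeps the inequality stable when a short time is added. *)
Lemma flow_growth (f : E -> R) c T x : continuous f ->
  (forall t e, 0 <= t -> t < T -> 0 < e -> exists2 s0, 0 < s0 &
     forall s, 0 <= s -> s <= s0 ->
       f (flow F s (flow F t x)) <= f (flow F t x) + s * (c + e)) ->
  forall t, 0 <= t -> t <= T -> f (flow F t x) <= f x + t * c.
Proof.
move=> fc h t t0 tT; apply/ler_addgt0Pr => e' e'0.
have [e e0 te] : exists2 e, 0 < e & t * e <= e'.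
  by exists (e' / (t + 1)); rewrite ?divr_gt0 ?mulrA ?ler_pdivrMr; nra.
suff : f (flow F t x) <= f x + t * (c + e) by rewrite mulrDr; lra.
move: tT; apply: (@real_induction R (fun t => t <= T ->
  f (flow F t x) <= f x + t * (c + e))) t0 => {t te e' e'0}.
- by rewrite (flow0 K_gt0 FK)// mul0r addr0.
- move=> t t0 IH; have [tT|Tt] := ltP t T; last first.
    exists 1 => // s s0 _ tsT; have -> : s = 0 by lra.
    by rewrite addr0; apply: IH; lra.
  have [s0 s00 hs] := h t e t0 tT e0; exists s0 => // s s1 s2 _.
  rewrite (flowD K_gt0 FK)// mulrDl; have := hs s s1 s2; have := IH (ltW tT); lra.
- move=> t t0 IH tT; apply/ler_addgt0Pr => e' e'0.
  have e'20 : 0 < e' / 2 by rewrite divr_gt0.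
  have := fc (flow F t x); move=> /cvgrPdist_lt/(_ _ e'20).
  move=> /nbhs_normP[d /= d0 hd].
  pose m := Num.min t (Num.min (d / 2 / K) (e' / 2 / (`|c + e| + 1))).
  have c10 : 0 < `|c + e| + 1 by rewrite ltr_wpDl.
  have m0 : 0 < m by rewrite !lt_min t0 !divr_gt0.
  have : m <= m by []; rewrite {2}/m !le_min !ler_pdivlMr// => /and3P[mt md me].
  have s0 : 0 <= t - m by lra.
  have st : t - m <= t by lra.
  have := flow_time K_gt0 FK Flip x s0 st.
  have -> : t - (t - m) = m by ring.
  move=> h1; have := hd (flow F (t - m) x) (_ : `|_ - _| < d).
  move=> /(_ ltac:(lra)) h2.
  have := IH (t - m) s0 ltac:(lra) ltac:(lra).
  have := ler_norm (f (flow F t x) - f (flow F (t - m) x)).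
  have := ler_norm (- (c + e)); rewrite normrN => h3.
  have : m * (- (c + e)) <= m * (`|c + e| + 1) by rewrite ler_wpM2l ?ltW//; lra.
  have -> : (t - m) * (c + e) = t * (c + e) + m * (- (c + e)) by ring.
  lra.
Qed.

(** Chain rule at time zero: the displacement is [s *: F y] up to order [s ^+ 2]. *)
Lemma flow_derivative (f Df : E -> R) M c y :
  (forall u v, Df (u - v) = Df u - Df v) ->
  (forall s v, Df (s *: v) = s * Df v) ->
  (forall v, `|Df v| <= M * `|v|) ->
  (forall e, 0 < e -> exists2 d, 0 < d &
     forall w, `|w| < d -> `|f (y + w) - f y - Df w| <= e * `|w|) ->
  Df (F y) <= c ->
  forall e, 0 < e -> exists2 s0, 0 < s0 &
     forall s, 0 <= s -> s <= s0 -> f (flow F s y) <= f y + s * (c + e).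
Proof.
move=> DB DZ DM fD Dc e e0.
have M0 : 0 <= `|M| by [].
have DM' v : `|Df v| <= `|M| * `|v|.
  by apply: (le_trans (DM v)); rewrite ler_wpM2r// ler_norm.
have e20 : 0 < e / 2 / K by rewrite !divr_gt0.
have [d d0 hd] := fD _ e20.
have [s1 [C [s10 C0 hs]]] := flow_expansion K_gt0 FK Flip y.
have MC0 : 0 < `|M| * C + 1 by rewrite ltr_wpDl// mulr_ge0// ltW.
exists (Num.min s1 (Num.min (d / 2 / K) (e / 2 / (`|M| * C + 1)))).
  by rewrite !lt_min s10 !divr_gt0.
move=> s s0; rewrite !le_min !ler_pdivlMr// => /and3P[ss1 sd se].
pose w := flow F s y - y.
have wK : `|w| <= K * s by exact: flow_dist.
have ws : `|w - s *: F y| <= C * s ^+ 2 by exact: hs.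
have wd : `|w| < d by lra.
have yw : y + w = flow F s y by rewrite /w addrC subrK.
have := hd w wd; rewrite yw => fw.
have Dw : Df w = s * Df (F y) + Df (w - s *: F y).
  by rewrite (DB w) DZ addrC subrK.
have h1 : e / 2 / K * `|w| <= e / 2 * s.
  have wKs : `|w| / K <= s by rewrite ler_pdivrMr// mulrC.
  have -> : e / 2 / K * `|w| = e / 2 * (`|w| / K) by ring.
  by apply: ler_wpM2l => //; lra.
have h2 : s * Df (F y) <= s * c by rewrite ler_wpM2l.
have h3 : `|Df (w - s *: F y)| <= s * (e / 2).
  apply: (le_trans (DM' _)); apply: (@le_trans _ _ (`|M| * (C * s ^+ 2))).
    by rewrite ler_wpM2l.
  have -> : `|M| * (C * s ^+ 2) = s * (s * (`|M| * C)) by ring.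
  by rewrite ler_wpM2l//; lra.
have := ler_norm (f (flow F s y) - f y - Df w).
have := ler_norm (Df (w - s *: F y)); lra.
Qed.

End Lyapunov.

(** * Locally Lipschitz maps *)

Section LocallyLipschitz.
Variable R : realType.

Lemma lipschitz_locally (V W : normedModType R) (f : V -> W) L :
  (forall x y, `|f x - f y| <= L * `|x - y|) -> locally_lipschitz f.
Proof.
move=> fL x; exists (`|L| + 1), 1; split=> //.
move=> y z _ _; apply: (le_trans (fL y z)); rewrite ler_wpM2r//.
by rewrite (le_trans (ler_norm L))// lerDl.
Qed.

Lemma locally_lipschitz_bounded (V W : normedModType R) (f : V -> W) :
  locally_lipschitz f -> forall x, exists L r M, [/\ 0 < L, 0 < r, 0 < M &
    (forall y z, `|x - y| < r -> `|x - z| < r -> `|f y - f z| <= L * `|y - z|) /\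
    (forall y, `|x - y| < r -> `|f y| <= M)].
Proof.
move=> fl x; have [L [r [L0 r0 h]]] := fl x.
exists L, r, (`|f x| + L * r); split=> //.
  by have := mulr_gt0 L0 r0; have := normr_ge0 (f x); lra.
split=> // y xy; have := h y x xy; rewrite subrr normr0 => /(_ r0) h1.
have : L * `|y - x| <= L * r by apply: ler_wpM2l; [exact: ltW | rewrite distrC ltW].
by have := ler_distD (f x) (f y) 0; rewrite !subr0; lra.
Qed.

Lemma locally_lipschitz_bilinear (V W X Y : normedModType R)
    (b : W -> X -> Y) C (f : V -> W) (g : V -> X) :
  (forall u v w, b (u - v) w = b u w - b v w) ->
  (forall u v w, b u (v - w) = b u v - b u w) ->
  (forall u v, `|b u v| <= C * (`|u| * `|v|)) ->
  locally_lipschitz f -> locally_lipschitz g ->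
  locally_lipschitz (fun x => b (f x) (g x)).
Proof.
move=> bl br bC /locally_lipschitz_bounded fl /locally_lipschitz_bounded gl x.
have [L1 [r1 [M1 [L10 r10 M10 [h1 k1]]]]] := fl x.
have [L2 [r2 [M2 [L20 r20 M20 [h2 k2]]]]] := gl x.
have bC' u v : `|b u v| <= (`|C| + 1) * (`|u| * `|v|).
  apply: (le_trans (bC u v)); rewrite ler_wpM2r ?mulr_ge0//.
  by rewrite (le_trans (ler_norm C))// lerDl.
have C0 : 0 < `|C| + 1 by rewrite ltr_wpDl.
exists ((`|C| + 1) * (L1 * M2 + M1 * L2)), (Num.min r1 r2); split.
- by rewrite mulr_gt0// addr_gt0// mulr_gt0.
- by rewrite lt_min r10.
move=> y z; rewrite !lt_min => /andP[y1 y2] /andP[z1 z2].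
have -> : b (f y) (g y) - b (f z) (g z) = b (f y - f z) (g y) + b (f z) (g y - g z).
  by rewrite bl br addrA subrK.
have p1 : `|b (f y - f z) (g y)| <= (`|C| + 1) * (L1 * `|y - z| * M2).
  apply: (le_trans (bC' _ _)); apply: ler_wpM2l; first exact: ltW.
  by apply: ler_pM => //; [exact: h1 | exact: k2].
have p2 : `|b (f z) (g y - g z)| <= (`|C| + 1) * (M1 * (L2 * `|y - z|)).
  apply: (le_trans (bC' _ _)); apply: ler_wpM2l; first exact: ltW.
  by apply: ler_pM => //; [exact: k1 | exact: h2].
have -> : (`|C| + 1) * (L1 * M2 + M1 * L2) * `|y - z| =
  (`|C| + 1) * (L1 * `|y - z| * M2) + (`|C| + 1) * (M1 * (L2 * `|y - z|)) by ring.
by apply: (le_trans (ler_normD _ _)); exact: lerD.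
Qed.

Lemma locally_lipschitzD (V W : normedModType R) (f g : V -> W) :
  locally_lipschitz f -> locally_lipschitz g -> locally_lipschitz (fun x => f x + g x).
Proof.
move=> fl gl x; have [L1 [r1 [L10 r10 h1]]] := fl x; have [L2 [r2 [L20 r20 h2]]] := gl x.
exists (L1 + L2), (Num.min r1 r2); split; rewrite ?addr_gt0 ?lt_min ?r10//.
move=> y z; rewrite !lt_min => /andP[y1 y2] /andP[z1 z2].
by rewrite opprD addrACA mulrDl (le_trans (ler_normD _ _))// lerD ?h1 ?h2.
Qed.

Lemma locally_lipschitzV (V : normedModType R) (f : V -> R) :
  locally_lipschitz f -> (forall x, 0 < f x) -> locally_lipschitz (fun x => (f x)^-1).
Proof.
move=> fl f0 x; have [L [r [L0 r0 h]]] := fl x.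
have fx := f0 x.
exists (L * (4 / (f x) ^+ 2)), (Num.min r (f x / 2 / L)); split.
- by rewrite mulr_gt0// divr_gt0// exprn_gt0.
- by rewrite lt_min r0 !divr_gt0.
have lb y : `|x - y| < Num.min r (f x / 2 / L) -> f x / 2 < f y.
  rewrite lt_min ltr_pdivlMr// => /andP[xr xf].
  have := h x y; rewrite subrr normr0 => /(_ r0 xr).
  by have := ler_norm (f x - f y); lra.
move=> y z yr zr; have := lb y yr; have := lb z zr => fz fy.
have := f0 y; have := f0 z => fz0 fy0.
have -> : (f y)^-1 - (f z)^-1 = (f z - f y) * ((f y)^-1 * (f z)^-1).
  by field; rewrite !gt_eqF.
rewrite normrM (ger0_norm (_ : 0 <= (f y)^-1 * (f z)^-1)); last first.
  by rewrite mulr_ge0 ?invr_ge0 ?ltW.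
rewrite (mulrAC L); apply: ler_pM => //.
- by rewrite mulr_ge0 ?invr_ge0 ?ltW.
- move: yr zr; rewrite !lt_min => /andP[yr _] /andP[zr _].
  by rewrite distrC; exact: h.
have inv u : f x / 2 < u -> u^-1 <= 2 / f x.
  move=> xu; have u0 : 0 < u by lra.
  by rewrite -[2 / f x]invf_div lef_pV2 ?posrE// ?divr_gt0// ltW.
have -> : 4 / f x ^+ 2 = (2 / f x) * (2 / f x) by field; rewrite gt_eqF.
by apply: ler_pM; rewrite ?inv// invr_ge0 ltW.
Qed.

Lemma locally_lipschitz_continuous (V W : normedModType R) (f : V -> W) :
  locally_lipschitz f -> continuous f.
Proof.
move=> fl x; have [L [r [L0 r0 h]]] := fl x.
apply/cvgrPdist_lt => e e0; apply/nbhs_normP.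
exists (Num.min r (e / L)); first by rewrite /= lt_min r0 divr_gt0.
move=> y /=; rewrite lt_min => /andP[yr ye].
apply: (le_lt_trans (h x y _ yr)); first by rewrite subrr normr0.
by rewrite mulrC -ltr_pdivlMr.
Qed.

Lemma locally_lipschitz_scale (E : normedModType R) (c : E -> R) (g : E -> E) :
  locally_lipschitz c -> locally_lipschitz g ->
  locally_lipschitz (fun x => c x *: g x).
Proof.
apply: (@locally_lipschitz_bilinear E R E E (fun (s : R) (y : E) => s *: y) 1).
- by move=> s t y; rewrite scalerBl.
- by move=> s y z; rewrite scalerBr.
- by move=> s y; rewrite normrZ mul1r.
Qed.

Lemma locally_lipschitz_id (E : normedModType R) : locally_lipschitz (id : E -> E).
Proof. by apply: (@lipschitz_locally _ _ _ 1) => x y; rewrite mul1r. Qed.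

Lemma locally_lipschitz_cst (V W : normedModType R) (w : W) :
  locally_lipschitz (fun _ : V => w).
Proof. by apply: (@lipschitz_locally _ _ _ 0) => x y; rewrite subrr normr0 mul0r. Qed.

End LocallyLipschitz.

(** * Locally Lipschitz selections *)

Section Inradius.
Variables (R : realType) (E : normedModType R).
Implicit Types (UU : set (set E)) (x y : E).

(** The cap at 1 and the value 0 keep this finite and nonnegative for every
family, the empty family included. For a single open set it is a Lipschitz
function that is positive exactly on the set. *)
Definition inradius UU x : R := sup [set r | 0 <= r <= 1 /\
  (r = 0 \/ exists2 U, UU U & forall y, `|x - y| < r -> U y)].

Lemma inradius_has_sup UU x : has_sup [set r : R | 0 <= r <= 1 /\
  (r = 0 \/ exists2 U, UU U & forall y, `|x - y| < r -> U y)].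
Proof.
split; first by exists 0; split; [rewrite lexx ler01 | left].
by exists 1 => r [/andP[]].
Qed.

Lemma inradius_ge0 UU x : 0 <= inradius UU x.
Proof.
apply: ub_le_sup; first by case: (inradius_has_sup UU x).
by split; [rewrite lexx ler01 | left].
Qed.

Lemma inradius_le1 UU x : inradius UU x <= 1.
Proof. by apply: ge_sup; [case: (inradius_has_sup UU x) | move=> r [/andP[]]]. Qed.

Lemma inradius_subset UU VV x : UU `<=` VV -> inradius UU x <= inradius VV x.
Proof.
move=> UV; apply: ge_sup; first by case: (inradius_has_sup UU x).
move=> r [r01 h]; apply: ub_le_sup; first by case: (inradius_has_sup VV x).
by split=> //; case: h => [|[U /UV VU h]]; [left | right; exists U].
Qed.

Lemma inradius_lipschitz UU x y : `|inradius UU x - inradius UU y| <= `|x - y|.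
Proof.
suff h u v : inradius UU u <= inradius UU v + `|u - v|.
  rewrite ler_norml; have := h x y; have := h y x; rewrite (distrC y x); lra.
apply: ge_sup; first by case: (inradius_has_sup UU u).
move=> r [/andP[r0 r1] h].
have [ruv|uvr] := leP r `|u - v|.
  by have := inradius_ge0 UU v; lra.
rewrite -lerBlDr; apply: ub_le_sup; first by case: (inradius_has_sup UU v).
split; first by apply/andP; split; have := normr_ge0 (u - v); lra.
case: h => [re|[U UU_U hU]]; first by have := normr_ge0 (u - v); lra.
right; exists U => // z vz; apply: hU.
by have := ler_distD v u z; lra.
Qed.

Lemma inradius_gt0 UU x : 0 < inradius UU x -> exists2 U, UU U & U x.
Proof.
move=> /(sup_gt (inradius_has_sup UU x).1)[r [_ [->|[U UUU h]]]]; first by rewrite ltxx.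
by move=> r0; exists U => //; apply: h; rewrite subrr normr0.
Qed.

Lemma open_inradius_gt0 UU U x : open U -> UU U -> U x -> 0 < inradius UU x.
Proof.
move=> oU UUU Ux; have /nbhs_normP[d /= d0 hd] : nbhs x U by exact: open_nbhs_nbhs.
apply: (@lt_le_trans _ _ (Num.min d 1)); first by rewrite lt_min d0 ltr01.
apply: ub_le_sup; first by case: (inradius_has_sup UU x).
split; first by rewrite le_min ltW//= ler01 ge_min lexx orbT.
by right; exists U => // y; rewrite lt_min => /andP[xy _]; apply: hd.
Qed.

End Inradius.

Section DisjointSums.
Variables (R : realType) (E : normedModType R).

(** The function [V] is the sum of the [f v x *: c v]. When two different bumps
are active at [x] and at [y], each of them vanishes at the other point, so its
value is at most [L * `|x - y|]; this accounts for the factor 2. *)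
Lemma disjoint_sum_lipschitz (W : normedModType R) (I : Type) (f : I -> E -> R)
    (c : I -> W) L :
  0 <= L -> (forall v x, 0 <= f v x) ->
  (forall v x y, `|f v x - f v y| <= L * `|x - y|) ->
  (forall v w x, 0 < f v x -> 0 < f w x -> v = w) ->
  (forall v x, 0 < f v x -> `|c v| <= 1) ->
  exists V : E -> W, [/\
    forall v x, 0 < f v x -> V x = f v x *: c v,
    forall x, (forall v, f v x = 0) -> V x = 0 &
    forall x y, `|V x - V y| <= 2 * L * `|x - y|].
Proof.
move=> L0 f0 fL fdisj c1.
have fE v x : f v x = 0 \/ 0 < f v x.
  by have := f0 v x; rewrite le_eqVlt => /orP[/eqP|]; [left | right].
have hV (x : E) : exists w : W, (forall v, 0 < f v x -> w = f v x *: c v) /\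
    ((forall v, f v x = 0) -> w = 0).
  have [[v fv]|nf] := pselect (exists v, 0 < f v x).
    exists (f v x *: c v); split; first by move=> u fu; rewrite (fdisj _ _ _ fv fu).
    by move=> /(_ v) h; rewrite h ltxx in fv.
  by exists 0; split=> // v fv; case: nf; exists v.
have [V VP] := choice hV; exists V; split.
- by move=> v x; apply: (VP x).1.
- by move=> x; apply: (VP x).2.
have Vle v x : 0 < f v x -> `|V x| <= f v x.
  move=> fv; rewrite ((VP x).1 v fv) normrZ ger0_norm//.
  by rewrite -[leRHS]mulr1 ler_wpM2l// (c1 v x).
move=> x y.
have fxy v : f v x <= L * `|x - y| + f v y.
  by have := ler_norm (f v x - f v y); have := fL v x y; lra.
have fyx v : f v y <= L * `|x - y| + f v x.
  by have := ler_norm (f v y - f v x); have := fL v y x; rewrite (distrC y x); lra.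
have act z : (exists2 v, 0 < f v z & forall w, w <> v -> f w z = 0) \/ (forall v, f v z = 0).
  have [[v fv]|nf] := pselect (exists v, 0 < f v z).
    left; exists v => // w wv; case: (fE w z) => // fw.
    by case: wv; exact: (fdisj _ _ z).
  by right=> v; case: (fE v z) => // fv; case: nf; exists v.
have d0 : 0 <= `|x - y| by [].
case: (act x) => [[v vx hx]|hx]; case: (act y) => [[w wy hy]|hy].
- have [vw|vw] := pselect (v = w).
    subst w; rewrite ((VP x).1 v vx) ((VP y).1 v wy) -scalerBl normrZ.
    have : `|f v x - f v y| * `|c v| <= `|f v x - f v y| * 1.
      by rewrite ler_wpM2l// (c1 v x).
    by have := fL v x y; have := normr_ge0 (f v x - f v y); lra.
  have := Vle v x vx; have := Vle w y wy; have := fxy v; have := fyx w.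
  by rewrite (hy v)// (hx w); [have := ler_normB (V x) (V y); lra | exact: nesym].
- rewrite ((VP y).2 hy) subr0; have := Vle v x vx; have := fxy v; rewrite hy.
  by have := f0 v x; lra.
- rewrite ((VP x).2 hx) sub0r normrN; have := Vle w y wy; have := fyx w; rewrite hx.
  by have := f0 w y; lra.
- rewrite ((VP x).2 hx) ((VP y).2 hy) subrr normr0.
  by rewrite !mulr_ge0.
Qed.

Definition mesh_sum (W : normedModType R) (u : nat -> E -> W) n x : W :=
  \sum_(k < n) mesh k *: u k x.

Lemma mesh_sum_cvg (W : completeNormedModType R) (u : nat -> E -> W) L :
  (forall n x, `|u n x| <= 1) ->
  (forall n x y, `|u n x - u n y| <= L * `|x - y|) ->
  exists Y : E -> W,
    (forall x e, 0 < e -> exists N, forall n, (N <= n)%N -> `|mesh_sum u n x - Y x| < e) /\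
    (forall x y, `|Y x - Y y| <= 2 * L * `|x - y|).
Proof.
move=> u1 uL.
have tail x m j : `|mesh_sum u (m + j) x - mesh_sum u m x| <= 2 * mesh m - 2 * mesh (m + j).
  elim: j => [|j IH]; first by rewrite addn0 !subrr normr0.
  rewrite addnS /mesh_sum big_ord_recr/= -/(mesh_sum u _ x) addrAC.
  apply: (le_trans (ler_normD _ _)).
  have : `|mesh (m + j) *: u (m + j)%N x| <= mesh (m + j).
    by rewrite normrZ gtr0_norm// -[leRHS]mulr1 ler_wpM2l// ltW.
  by rewrite -/(mesh_sum u m x) meshS; lra.
have lip n x y : `|mesh_sum u n x - mesh_sum u n y| <= (2 - 2 * mesh n) * (L * `|x - y|).
  elim: n => [|n IH].
    by rewrite /mesh_sum !big_ord0 subrr normr0 /mesh expr0 mulr1 subrr mul0r.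
  rewrite /mesh_sum !big_ord_recr/= -/(mesh_sum u n x) -/(mesh_sum u n y) opprD addrACA.
  apply: (le_trans (ler_normD _ _)).
  have : `|mesh n *: u n x - mesh n *: u n y| <= mesh n * (L * `|x - y|).
    by rewrite -scalerBr normrZ gtr0_norm// ler_wpM2l// ltW.
  by rewrite meshS; move: IH; set d := L * _; set m := mesh n => *; lra.
have hY x : exists l, forall e, 0 < e -> exists N, forall n, (N <= n)%N -> `|mesh_sum u n x - l| < e.
  apply: cauchy_limit => e e0; have e40 : 0 < e / 4 by rewrite divr_gt0.
  have [N hN] := @mesh_small R _ e40.
  exists N => n m Nn Nm.
  have key p : (N <= p)%N -> `|mesh_sum u p x - mesh_sum u N x| < e / 2.
    move=> Np; have := tail x N (p - N)%N; rewrite subnKC// => h.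
    by have := hN N (leqnn N); have := @mesh_gt0 R p; lra.
  have := ler_distD (mesh_sum u N x) (mesh_sum u n x) (mesh_sum u m x).
  by have := key n Nn; have := key m Nm; rewrite (distrC (mesh_sum u N x)); lra.
have [Y YP] := choice hY; exists Y; split=> // x y.
apply/ler_addgt0Pr => e e0; have e20 : 0 < e / 2 by rewrite divr_gt0.
have [N hN] := YP x _ e20; have [M hM] := YP y _ e20.
pose n := maxn N M.
have := hN n (leq_maxl _ _); have := hM n (leq_maxr _ _); have := lip n x y.
have L0 : 0 <= L * `|x - y| by exact: le_trans (uL 0%N x y).
have : (2 - 2 * mesh n) * (L * `|x - y|) <= 2 * (L * `|x - y|).
  by rewrite ler_wpM2r//; have := @mesh_gt0 R n; lra.
have := ler_distD (mesh_sum u n x) (Y x) (Y y).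
have := ler_distD (mesh_sum u n y) (mesh_sum u n x) (Y y).
rewrite (distrC (Y x) (mesh_sum u n x)); lra.
Qed.

End DisjointSums.

Section Selection.
Variables (R : realType) (E : completeNormedModType R).

Lemma max0_lipschitz (a b : R) : `|Num.max 0 a - Num.max 0 b| <= `|a - b|.
Proof.
rewrite ler_norml; have := ler_norm (a - b); have := ler_norm (b - a).
by rewrite (distrC b); case: (leP 0 a) => ?; case: (leP 0 b) => ? *; lra.
Qed.

(** The value at [x] is the fraction [lam] of an average of vectors admissible at
[x], possibly an infinite one; this is expressed by testing against sublinear
functions. The fraction is 1 on [B]. *)
Lemma lipschitz_selection (C : E -> E -> Prop) (B : set E) :
  (forall v, open [set x | C x v]) -> (forall x v, C x v -> `|v| <= 1) ->
  closed B -> (forall x, B x -> exists v, C x v) ->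
  exists Z : E -> E, locally_lipschitz Z /\ forall x, exists lam : R,
    [/\ 0 <= lam, lam <= 1, (B x -> lam = 1) &
      forall (g : E -> R) c, continuous g ->
        (forall u v, g (u + v) <= g u + g v) ->
        (forall s v, 0 <= s -> g (s *: v) = s * g v) ->
        (forall v, C x v -> g v <= c) -> g (Z x) <= lam * c].
Proof.
move=> Copen C1 Bcl BC.
have [le wo] := well_ordering_principle E.
pose U v := [set x | C x v].
pose d v x := inradius [set U v] x.
pose db v x := inradius [set U w | w in [set w | le w v /\ w <> v]] x.
(* [f n v] is positive only where [x] is deep inside [U v] and nearly outside
   every [U w] with [w] before [v]. If also [f n w x > 0] with [w] before [v], then
   [db v x >= d w x > mesh n], whereas [db v x < mesh n].
   At a given [x], [f n v x] is positive for the least admissible [v] as soon as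
   [mesh n < d v x], because [db v x = 0] for that [v]. *)
pose f n v x := Num.max 0 (mesh n * (d v x - mesh n) - db v x).
have mesh1 n : mesh n <= 1 :> R by have := @mesh_le R 0 n isT.
have f0 n v x : 0 <= f n v x by rewrite le_max lexx.
have f1 n v x : f n v x <= 1.
  rewrite ge_max ler01/=; have := inradius_ge0 [set U w | w in [set w | le w v /\ w <> v]] x.
  have := inradius_le1 [set U v] x; rewrite -/(d v x) -/(db v x) => d1 db0.
  have := @mesh_gt0 R n; have := mesh1 n; set m := mesh n => m1 m0.
  have : m * (d v x - m) <= 1 * 1 by apply: (@le_trans _ _ (m * 1)); [rewrite ler_wpM2l|rewrite ler_wpM2r]; lra.
  lra.
have fL n v x y : `|f n v x - f n v y| <= 2 * `|x - y|.
  apply: (le_trans (max0_lipschitz _ _)).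
  have -> : mesh n * (d v x - mesh n) - db v x - (mesh n * (d v y - mesh n) - db v y) =
    mesh n * (d v x - d v y) - (db v x - db v y) by ring.
  apply: (le_trans (ler_normB _ _)); rewrite normrM gtr0_norm//.
  have h1 : `|db v x - db v y| <= `|x - y| by exact: inradius_lipschitz.
  have h2 : mesh n * `|d v x - d v y| <= 1 * `|x - y|.
    by apply: ler_pM => //; [exact: ltW | exact: inradius_lipschitz].
  lra.
have fgt0 n v x : 0 < f n v x -> [/\ d v x > mesh n, db v x < mesh n & C x v].
  rewrite lt_max ltxx/= subr_gt0 => h.
  have db0 : 0 <= db v x by exact: inradius_ge0.
  have d1 : d v x <= 1 by exact: inradius_le1.
  have m0 := @mesh_gt0 R n.
  have dm : 0 < d v x - mesh n by rewrite -(pmulr_rgt0 _ m0); lra.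
  have hm : mesh n * (d v x - mesh n) <= mesh n * 1 by rewrite ler_wpM2l//; lra.
  split; [lra | lra |].
  have : 0 < d v x by lra.
  by move=> /inradius_gt0[_ ->].
have dle v w x : le w v -> w <> v -> d w x <= db v x.
  by move=> wv nwv; apply: inradius_subset => _ ->; exists w.
have wo2 : wo_chain le (mem E) := withinW wo.
have letot := wo_chainW wo2.
have fdisj n v w x : 0 < f n v x -> 0 < f n w x -> v = w.
  move=> /fgt0[v1 v2 _] /fgt0[w1 w2 _]; apply: contrapT => vw.
  case/orP: (letot v w isT isT) => h.
    by have := dle w v x h vw; lra.
  by have := dle v w x h (nesym vw); lra.
have hV n : exists g : E -> E, [/\
    forall v x, 0 < f n v x -> g x = f n v x *: v,
    forall x, (forall v, f n v x = 0) -> g x = 0 &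
    forall x y, `|g x - g y| <= 2 * 2 * `|x - y|].
  apply: (@disjoint_sum_lipschitz R E E E (f n) id 2) => //.
  - exact: fdisj.
  - by move=> v x /fgt0[_ _]; exact: C1.
have hS n : exists g : E -> R, [/\
    forall v x, 0 < f n v x -> g x = f n v x *: (1 : R),
    forall x, (forall v, f n v x = 0) -> g x = 0 &
    forall x y, `|g x - g y| <= 2 * 2 * `|x - y|].
  apply: (@disjoint_sum_lipschitz R E R E (f n) (fun=> 1) 2) => //.
  - exact: fdisj.
  - by move=> v x _; rewrite normr1.
have [V VP] := choice hV; have [S SP] := choice hS.
have VS n x : (exists v, [/\ C x v, S n x = f n v x & V n x = f n v x *: v]) \/
    (S n x = 0 /\ V n x = 0).
  have [V1 V2 _] := VP n; have [S1 S2 _] := SP n.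
  have [[v fv]|nf] := pselect (exists v, 0 < f n v x).
    left; exists v; rewrite (V1 _ _ fv) (S1 _ _ fv) [_ *: 1]mulr1; split=> //.
    by case: (fgt0 n v x fv).
  right; have fz v : f n v x = 0.
    have := f0 n v x; rewrite le_eqVlt => /orP[/eqP//|fv]; by case: nf; exists v.
  by rewrite V2// S2.
have S01 n x : 0 <= S n x <= 1.
  by case: (VS n x) => [[v [_ -> _]]|[-> _]]; rewrite ?f0 ?f1 ?lexx ?ler01.
have [Y [Ycvg YL]] : exists Y : E -> E,
    (forall x e, 0 < e -> exists N, forall n, (N <= n)%N -> `|mesh_sum V n x - Y x| < e) /\
    (forall x y, `|Y x - Y y| <= 2 * (2 * 2) * `|x - y|).
  apply: mesh_sum_cvg; last by move=> n; case: (VP n).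
  move=> n x; case: (VS n x) => [[v [Cv _ ->]]|[_ ->]]; last by rewrite normr0.
  rewrite normrZ ger0_norm// -[leRHS]mulr1; by apply: ler_pM => //; exact: C1 Cv.
have [T [Tcvg TL]] : exists T : E -> R,
    (forall x e, 0 < e -> exists N, forall n, (N <= n)%N -> `|mesh_sum S n x - T x| < e) /\
    (forall x y, `|T x - T y| <= 2 * (2 * 2) * `|x - y|).
  apply: (@mesh_sum_cvg R); last by move=> n; case: (SP n).
  by move=> n x; have /andP[h1 h2] := S01 n x; rewrite ger0_norm.
have Sge0 n x : 0 <= mesh_sum S n x.
  apply: sumr_ge0 => k _; have /andP[h _] := S01 k x.
  by apply: mulr_ge0 => //; exact: ltW.
have Tge n x : mesh_sum S n x <= T x.
  apply/ler_addgt0Pr => e e0; have [N hN] := Tcvg x e e0.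
  have h : mesh_sum S n x <= mesh_sum S (maxn n N) x.
    rewrite -(subnKC (leq_maxl n N)); elim: (maxn n N - n)%N => [|j IH]; first by rewrite addn0.
    rewrite addnS {2}/mesh_sum big_ord_recr/= -/(mesh_sum S (n + j) x) (le_trans IH)//.
    rewrite lerDl; have /andP[h _] := S01 (n + j)%N x.
    by apply: mulr_ge0 => //; exact: ltW.
  have := hN _ (leq_maxr n N); have := ler_norm (mesh_sum S (maxn n N) x - T x); lra.
have T0 x : 0 <= T x by exact: le_trans (Tge 0%N x).
have Tpos x : (exists v, C x v) -> 0 < T x.
  move=> [v Cv]; have [|v0 [[/= Cv0 v0min] _]] := wo [pred v | `[< C x v >]].
    by exists v; apply/asboolP.
  have {}Cv0 : C x v0 by apply/asboolP.
  have dv0 : 0 < d v0 x by apply: (@open_inradius_gt0 _ _ _ (U v0)) => //; exact: Copen.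
  have [n hn] := @mesh_small R _ dv0; have {hn} dn := hn n (leqnn n).
  have db0 : db v0 x = 0.
    apply/eqP; rewrite eq_le inradius_ge0 andbT leNgt; apply/negP.
    move=> /inradius_gt0[_ [w [wv nwv] <-] Cw]; apply: nwv.
    have v0w : le v0 w by apply: v0min; apply/asboolP.
    by apply: (wo_chain_antisymmetric wo2) => //; rewrite wv v0w.
  have fv0 : 0 < f n v0 x by rewrite lt_max db0 subr0 mulr_gt0 ?orbT// subr_gt0.
  apply: lt_le_trans (Tge n.+1 x).
  rewrite /mesh_sum big_ord_recr/= -/(mesh_sum S n x) ltr_wpDl//.
  have [S1 _ _] := SP n; rewrite (S1 _ _ fv0) [_ *: 1]mulr1.
  exact: mulr_gt0.
(* The second term vanishes exactly on [B], where [T] is positive; so [D] is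
   positive everywhere, and equal to [T] on [B]. *)
pose D x := T x + inradius [set ~` B] x.
have Bin x : ~ B x -> 0 < inradius [set ~` B] x.
  by move=> nBx; apply: (@open_inradius_gt0 _ _ _ (~` B)) => //; exact: closed_openC.
have D0 x : 0 < D x.
  have [Bx|nBx] := pselect (B x); last by rewrite ltr_wpDl// Bin.
  by rewrite ltr_wpDr ?inradius_ge0// Tpos//; exact: BC.
have DL : locally_lipschitz D.
  apply: locally_lipschitzD; first exact: lipschitz_locally TL.
  apply: (@lipschitz_locally _ _ _ _ 1) => x y; rewrite mul1r.
  exact: inradius_lipschitz.
exists (fun x => (D x)^-1 *: Y x); split.
  apply: (@locally_lipschitz_bilinear R E R E E (fun (a : R) (y : E) => a *: y) 1).
  - by move=> a b y; rewrite scalerBl.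
  - by move=> a y z; rewrite scalerBr.
  - by move=> a y; rewrite normrZ mul1r.
  - exact: locally_lipschitzV.
  - exact: lipschitz_locally YL.
move=> x; exists (T x / D x); split.
- by rewrite divr_ge0// ltW.
- by rewrite ler_pdivrMr// mul1r lerDl inradius_ge0.
- move=> Bx; have -> : D x = T x.
    rewrite /D; suff -> : inradius [set ~` B] x = 0 by rewrite addr0.
    apply/eqP; rewrite eq_le inradius_ge0 andbT leNgt; apply/negP.
    by move=> /inradius_gt0[_ ->]; exact.
  by rewrite divff// gt_eqF// Tpos//; exact: BC.
move=> g c gc gD gZ Cg; have D1 : 0 <= (D x)^-1 by rewrite invr_ge0 ltW.
rewrite gZ//; have -> : T x / D x * c = (D x)^-1 * (T x * c) by ring.
apply: ler_wpM2l => //.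
have g0 : g 0 = 0 by have := gZ 0 0 (lexx 0); rewrite scaler0 mul0r.
have gsum n : g (mesh_sum V n x) <= mesh_sum S n x * c.
  elim: n => [|n IH]; first by rewrite /mesh_sum !big_ord0 g0 mul0r.
  rewrite /mesh_sum !big_ord_recr/= -/(mesh_sum V n x) -/(mesh_sum S n x).
  apply: (le_trans (gD _ _)); rewrite mulrDl lerD//.
  have -> : (mesh n *: S n x) * c = mesh n * (S n x * c) by rewrite mulrA.
  have m0 : 0 <= mesh n :> R by exact: ltW.
  rewrite gZ//; apply: ler_wpM2l => //.
  case: (VS n x) => [[v [Cv -> ->]]|[-> ->]]; last by rewrite g0 mul0r.
  by rewrite gZ// ler_wpM2l// Cg.
apply/ler_addgt0Pr => e e0.
have e20 : 0 < e / 2 by rewrite divr_gt0.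
have ec0 : 0 < e / 2 / (`|c| + 1) by rewrite divr_gt0// ltr_wpDl.
have := gc (Y x) => /cvgrPdist_lt/(_ _ e20)/nbhs_normP[r /= r0 hr].
have [N hN] := Ycvg x _ r0; have [M hM] := Tcvg x _ ec0.
pose n := maxn N M.
have := hr _ (_ : `|Y x - mesh_sum V n x| < r).
rewrite distrC => /(_ (hN n (leq_maxl _ _))) h1.
have := hM n (leq_maxr _ _); rewrite ltr_pdivlMr ?ltr_wpDl// => h2.
have h3 : (mesh_sum S n x - T x) * c <= `|mesh_sum S n x - T x| * (`|c| + 1).
  rewrite (le_trans (ler_norm _))// normrM ler_wpM2l//; lra.
have := gsum n; have := ler_norm (g (Y x) - g (mesh_sum V n x)); lra.
Qed.
End Selection.

(** * Derivatives and scalar products *)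

Section Calculus.
Variable R : realType.

Lemma differentiable_expansion (E : normedModType R) (phi : E -> R) u :
  differentiable phi u -> forall e, 0 < e -> exists2 d, 0 < d &
    forall w, `|w| < d -> `|phi (u + w) - phi u - 'd phi u w| <= e * `|w|.
Proof.
move=> /diff_locally/eqaddoP h e e0; have := h e e0.
move=> /nbhs_normP[d /= d0 hd]; exists d => // w wd.
have /hd : `|0 - w| < d by rewrite sub0r normrN.
by rewrite /= opprD addrA (addrC u).
Qed.

Lemma functional_norm_le (E : completeNormedModType R) (f : E -> R) M v :
  (forall w, `|f w| <= M * `|w|) -> (forall s w, f (s *: w) = s * f w) ->
  `|f v| <= dual_norm f * `|v|.
Proof.
move=> fM fZ; have [->|v0] := eqVneq v 0.
  by have := fM 0; rewrite normr0 !mulr0.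
have nv : 0 < `|v| by rewrite normr_gt0.
rewrite -ler_pdivrMr//; apply: ub_le_sup.
  by exists M => _ [w [_ w1] <-]; have := fM w; rewrite w1 mulr1.
exists (`|v|^-1 *: v); last by rewrite fZ normrM gtr0_norm ?invr_gt0// mulrC.
by split=> //; rewrite normrZ gtr0_norm ?invr_gt0// mulVf// gt_eqF.
Qed.

(** A positive supremum is a genuine one, since the supremum of an empty set is
zero. *)
Lemma functional_norm_witness (E : completeNormedModType R) (T : set E) (f : E -> R) c :
  0 < c -> c < functional_norm T f -> exists v, [/\ T v, `|v| = 1 & c < `|f v|].
Proof.
move=> c0 cf.
have ne : [set `|f v| | v in [set v | T v /\ `|v| = 1]] !=set0.
  apply/set0P/eqP => e; move: cf; rewrite /functional_norm e sup0; lra.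
by have [_ [v [Tv v1] <-] cv] := sup_gt ne cf; exists v.
Qed.

Lemma dot_CauchySchwarz (H : normedModType R) (ip : {dot H for idfun}) :
  (forall h : H, `|h| = Num.sqrt (ip h h)) ->
  forall x y, `|ip x y| <= `|x| * `|y|.
Proof.
move=> ipn.
have ip0 h : 0 <= ip h h.
  by have [->|h0] := eqVneq h 0; [rewrite linear0l | rewrite ltW// neq0_dnorm_gt0].
have ipE h : ip h h = `|h| ^+ 2 by rewrite ipn sqr_sqrtr.
have ipC x y : ip x y = ip y x by rewrite hermC expr0 mul1r.
have ipZ s x y : ip (s *: x) y = s * ip x y by rewrite linearZl_LR.
have ipB x y z : ip (x - y) z = ip x z - ip y z by rewrite linearBl.
suff key x y : ip x y <= `|x| * `|y|.
  move=> x y; rewrite ler_norml key andbT.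
  by have := key (- x) y; rewrite linearNl normrN; lra.
have [->|x0] := eqVneq x 0; first by rewrite linear0l normr0 mul0r.
have [->|y0] := eqVneq y 0; first by rewrite linear0r normr0 mulr0.
have h := ip0 (`|y| *: x - `|x| *: y).
rewrite ipB 2!ipZ [ip x (_ - _)]ipC [ip y (_ - _)]ipC !ipB !ipZ !ipE (ipC y x) in h.
have xy0 : 0 < `|x| * `|y| by rewrite mulr_gt0 ?normr_gt0.
rewrite -(ler_pM2l xy0); nra.
Qed.
Lemma open_lt_continuous (E : topologicalType) (f : E -> R) c : continuous f -> open [set u | f u < c].
Proof.
move=> fc; apply: (@open_comp _ _ f [set y | y < c]); last exact: open_lt.
by move=> x _; exact: fc.
Qed.

End Calculus.

(** * The descent field *)

Section DescentField.
Variables (R : realType) (E H : completeNormedModType R).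
Variables (ip : {dot H for idfun}) (i : {linear E -> H}).
Hypothesis ip_norm : forall h : H, `|h| = Num.sqrt (ip h h).
Hypothesis i_cont : continuous i.

Definition pullback u v : R := ip (i u) (i v).

Lemma pullbackBl u v w : pullback (u - v) w = pullback u w - pullback v w.
Proof. by rewrite /pullback raddfB linearBl. Qed.

Lemma pullbackBr u v w : pullback u (v - w) = pullback u v - pullback u w.
Proof. by rewrite /pullback !raddfB. Qed.

Lemma pullbackZr u s v : pullback u (s *: v) = s * pullback u v.
Proof. by rewrite /pullback linearZ linearZr_LR. Qed.

Lemma pullbackC u v : pullback u v = pullback v u.
Proof. by rewrite /pullback hermC expr0 mul1r. Qed.

Lemma pullback_norm u : pullback u u = `|i u| ^+ 2.
Proof.
have ip0 h : 0 <= ip h h.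
  by have [->|h0] := eqVneq h 0; [rewrite linear0l | rewrite ltW// neq0_dnorm_gt0].
by rewrite ip_norm sqr_sqrtr.
Qed.

Lemma pullback_bounded : exists2 C, 0 < C & forall u v, `|pullback u v| <= C * (`|u| * `|v|).
Proof.
have [k k0 hk] := linear_lipschitz i_cont; exists (k * k); first exact: mulr_gt0.
move=> u v; apply: (le_trans (dot_CauchySchwarz ip_norm _ _)).
have -> : k * k * (`|u| * `|v|) = (k * `|u|) * (k * `|v|) by ring.
by apply: ler_pM.
Qed.

(** On the unit sphere this is the orthogonal projection of [v] to the tangent
space at [u]. The factor [pullback u u] makes it orthogonal to [u] for every
[u], with no division. *)
Definition tangential u v : E := pullback u u *: v - pullback u v *: u.

Lemma tangential_tangent u v : pullback u (tangential u v) = 0.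
Proof. by rewrite /tangential pullbackBr !pullbackZr mulrC subrr. Qed.

Lemma tangentialZ u s v : tangential u (s *: v) = s *: tangential u v.
Proof. by rewrite /tangential pullbackZr scalerBr !scalerA mulrC. Qed.

Lemma tangentialB u v w : tangential u (v - w) = tangential u v - tangential u w.
Proof.
by rewrite /tangential pullbackBr scalerBr scalerBl !opprB !addrA [LHS](ACl (1*4*3*2)).
Qed.

Lemma pullback_locally_lipschitz (f g : E -> E) :
  locally_lipschitz f -> locally_lipschitz g ->
  locally_lipschitz (fun x => pullback (f x) (g x)).
Proof.
have [C _ hC] := pullback_bounded.
exact: (locally_lipschitz_bilinear pullbackBl pullbackBr hC).
Qed.

Lemma tangential_locally_lipschitz (f g : E -> E) :
  locally_lipschitz f -> locally_lipschitz g ->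
  locally_lipschitz (fun x => tangential (f x) (g x)).
Proof.
move=> fl gl; apply: (@locally_lipschitzD _ _ _ (fun x => pullback (f x) (f x) *: g x)).
  by apply: locally_lipschitz_scale => //; exact: pullback_locally_lipschitz.
have -> : (fun x => - (pullback (f x) (g x) *: f x)) =
  (fun x => pullback (f x) (g x) *: ((-1 : R) *: f x)).
  by apply/funext => x; rewrite scaleN1r scalerN.
apply: locally_lipschitz_scale; first exact: pullback_locally_lipschitz.
by apply: locally_lipschitz_scale => //; exact: locally_lipschitz_cst.
Qed.

Variable phi : E -> R.
Hypothesis phi_C1 : continuously_differentiable phi.

Lemma C1_continuous : continuous phi.
Proof. by move=> u; apply: differentiable_continuous; exact: phi_C1.1. Qed.

Lemma differential_bounded u : exists2 k, 0 < k & forall v, `|'d phi u v| <= k * `|v|.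
Proof.
have dc : continuous ('d phi u) by apply: diff_continuous; exact: phi_C1.1.
by have [k k0 hk] := linear_lipschitz dc; exists k.
Qed.

(** Continuity of the derivative in the dual norm is what allows the direction to
vary with the point. *)
Lemma differential_continuous (g : E -> E) : continuous g ->
  continuous (fun u => 'd phi u (g u)).
Proof.
move=> gc x; apply/cvgrPdist_lt => e e0.
have e20 : 0 < e / 2 by rewrite divr_gt0.
have [k k0 hk] := differential_bounded x.
have G0 : 0 < `|g x| + 1 by rewrite ltr_wpDl.
have ek0 : 0 < e / 2 / k by rewrite divr_gt0.
have eG0 : 0 < e / 2 / (`|g x| + 1) by rewrite divr_gt0.
have /cvgrPdist_lt/(_ _ eG0) near1 := phi_C1.2 x.
have /cvgrPdist_lt/(_ _ ek0) near2 := gc x.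
have /cvgrPdist_lt/(_ _ ltr01) near3 := gc x.
near=> y.
have h1 : `|0 - dual_norm (fun w => 'd phi y w - 'd phi x w)| < e / 2 / (`|g x| + 1).
  by near: y.
have h2 : `|g x - g y| < e / 2 / k by near: y.
have h3 : `|g x - g y| < 1 by near: y.
have [k' k'0 hk'] := differential_bounded y.
have h4 : `|'d phi y (g y) - 'd phi x (g y)| <=
    dual_norm (fun w => 'd phi y w - 'd phi x w) * `|g y|.
  apply: (@functional_norm_le R E (fun w => 'd phi y w - 'd phi x w) (k' + k)).
    move=> w; rewrite mulrDl; apply: (le_trans (ler_normB _ _)); exact: lerD.
  move=> s w; have dZ z : 'd phi z (s *: w) = s * 'd phi z w by rewrite linearZ.
  by rewrite !dZ mulrBr.
have h5 : `|'d phi x (g x) - 'd phi x (g y)| < e / 2.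
  rewrite -raddfB; apply: (le_lt_trans (hk _)).
  by move: h2; rewrite ltr_pdivlMr// mulrC.
have h6 : `|g y| <= `|g x| + 1.
  by have := ler_distD (g x) (g y) 0; rewrite !subr0 (distrC (g y)); lra.
have h7 : dual_norm (fun w => 'd phi y w - 'd phi x w) * `|g y| <= e / 2.
  move: h1; rewrite sub0r normrN ltr_pdivlMr// => h1.
  apply: (le_trans (ler_norm _)); rewrite normrM normr_id.
  apply: le_trans (ltW h1); exact: ler_wpM2l.
have := ler_distD ('d phi x (g y)) ('d phi x (g x)) ('d phi y (g y)).
by rewrite (distrC ('d phi x (g y))); lra.
Unshelve. all: by end_near. Qed.

Variables (S : set E) (a eps delta : R).
Hypotheses (eps_gt0 : 0 < eps) (delta_gt0 : 0 < delta).
Hypothesis phi_S : forall u : E,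
  (unit_sphere i `&` phi @^-1` `[a - 2 * eps, a + 2 * eps]
     `&` enlargement S (2 * delta)) u ->
  8 * eps / delta <= constrained_derivative_norm ip i phi u.

Definition descent_direction (u v : E) : Prop :=
  [/\ `|v| <= 1, `|tangential u v| < 1,
     4 * eps / delta < 'd phi u (tangential u v),
     `|phi u - a| < 2 * eps & enlargement S (2 * delta) u].

Lemma tangential_continuous v : continuous (fun u => tangential u v).
Proof.
apply: locally_lipschitz_continuous; apply: tangential_locally_lipschitz.
  exact: locally_lipschitz_id.
exact: locally_lipschitz_cst.
Qed.

Lemma open_enlargement r : open (enlargement S r).
Proof.
rewrite openE => v [u Su uv]; apply/nbhs_normP.
exists (r - `|u - v|); first by rewrite /= subr_gt0.
by move=> w /= vw; exists u => //; have := ler_distD v u w; lra.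
Qed.

Lemma open_descent_direction v : open [set u | descent_direction u v].
Proof.
have [v1|nv1] := pselect (`|v| <= 1); last first.
  have -> : [set u | descent_direction u v] = set0.
    by apply/seteqP; split=> // u [].
  exact: open0.
have -> : [set u | descent_direction u v] =
  [set u | `|tangential u v| < 1] `&` [set u | - 'd phi u (tangential u v) < - (4 * eps / delta)]
  `&` [set u | `|phi u - a| < 2 * eps] `&` enlargement S (2 * delta).
  apply/seteqP; split=> u /=; first by move=> [_ h1 h2 h3 h4]; rewrite ltrN2.
  by rewrite ltrN2 => -[[[h1 h2] h3] h4].
apply: openI; last exact: open_enlargement.
apply: openI.
  apply: openI; apply: open_lt_continuous.
    by move=> u; apply: cvg_norm; exact: tangential_continuous.
  move=> u; apply: cvgN; apply: differential_continuous; exact: tangential_continuous.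
apply: open_lt_continuous => u; apply: cvg_norm; apply: cvgB; last exact: cvg_cst.
exact: C1_continuous.
Qed.

(** The supremum in the hypothesis gives, up to sign, a unit tangent vector with
slope above [6 * eps / delta]. Shrinking it by [3 / 4] makes the length bound
strict and keeps the slope above [4 * eps / delta]. *)
Lemma descent_direction_exists u : unit_sphere i u -> `|phi u - a| < 2 * eps ->
  enlargement S (2 * delta) u -> exists v, descent_direction u v.
Proof.
move=> u1 ua uS.
have c0 : 0 < 6 * eps / delta by rewrite divr_gt0// mulr_gt0.
have dn : 6 * eps / delta < functional_norm (tangent_space ip i u) ('d phi u).
  apply: (@lt_le_trans _ _ (8 * eps / delta)).
    by rewrite ltr_pM2r ?invr_gt0// ltr_pM2r// ltr_nat.
  apply: phi_S; split=> //; split=> //=.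
  by rewrite in_itv/=; move: ua; rewrite ltr_norml; lra.
have [v [Tv v1 dv]] := functional_norm_witness c0 dn.
have [w [Tw w1 dw]] : exists w, [/\ pullback u w = 0, `|w| = 1 & 6 * eps / delta < 'd phi u w].
  have [d0|d0] := leP 0 ('d phi u v); first by exists v; rewrite -(ger0_norm d0).
  exists (- v); rewrite normrN raddfN -(ltr0_norm d0); split=> //.
  by rewrite -scaleN1r pullbackZr (Tv : pullback u v = 0) mulr0.
have dZ s : 'd phi u (s *: w) = s * 'd phi u w by rewrite linearZ.
have t1 : tangential u (3 / 4 *: w) = 3 / 4 *: w.
  by rewrite tangentialZ /tangential pullback_norm u1 expr1n scale1r Tw scale0r subr0.
have n34 : `|3 / 4 : R| = 3 / 4 by rewrite ger0_norm// divr_ge0.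
exists (3 / 4 *: w); split=> //; rewrite ?t1 ?(@normrZ R E) ?w1 ?n34 ?dZ; lra.
Qed.

(** Each bound on the field is a sublinear test of the selection. The speed
[delta / 2] turns the slope [4 * eps / delta] into the decrease rate
[2 * eps]. *)
Lemma descent_field : exists F : E -> E, [/\
  locally_lipschitz F, (forall u, `|F u| <= delta / 2),
  (forall u, pullback u (F u) = 0),
  (forall u, 'd phi u (F u) <= 0) &
  (forall u, ~ (`|phi u - a| < 2 * eps /\ enlargement S (2 * delta) u) -> F u = 0) /\
  (forall u, unit_sphere i u -> `|phi u - a| <= eps -> enlargement S delta u ->
     'd phi u (F u) <= - (2 * eps))].
Proof.
pose B0 : set E := [set u | [/\ unit_sphere i u, `|phi u - a| <= eps & enlargement S delta u]].
have cn : continuous (fun u => `|i u|) by move=> u; apply: cvg_norm; exact: i_cont.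
have cp : continuous (fun u => `|phi u - a|).
  by move=> u; apply: cvg_norm; apply: cvgB; [exact: C1_continuous | exact: cvg_cst].
have BC u : closure B0 u -> exists v, descent_direction u v.
  move=> Bu; apply: descent_direction_exists.
  - have cl : closed (unit_sphere i).
      apply: (@preimage_closed _ _ (fun u => `|i u|) [set y | y = 1]); last exact: closed_eq.
      by move=> x _; exact: cn.
    by apply: cl; apply: closureS Bu => v [].
  - have cl : closed [set u | `|phi u - a| <= eps].
      apply: (@preimage_closed _ _ (fun u => `|phi u - a|) [set y | y <= eps]); last exact: closed_le.
      by move=> x _; exact: cp.
    have : [set u | `|phi u - a| <= eps] u by apply: cl; apply: closureS Bu => v [].
    by move=> /= h; apply: (le_lt_trans h); rewrite ltr_pMl// ltr1n.
  - have [] := Bu (ball u delta) (nbhsx_ballx _ _ delta_gt0).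
    move=> v [[_ _ [s Ss sv]]]; rewrite -ball_normE /= => uv; exists s => //.
    by have := ler_distD v s u; rewrite (distrC v); lra.
have [Z [Zl ZP]] := lipschitz_selection open_descent_direction
  (fun u v (h : descent_direction u v) => let: And5 h1 _ _ _ _ := h in h1)
  (@closed_closure _ B0) BC.
have tcont u : continuous (tangential u).
  apply: locally_lipschitz_continuous; apply: (@tangential_locally_lipschitz (fun=> u) id).
    exact: locally_lipschitz_cst.
  exact: locally_lipschitz_id.
have dcont u : continuous ('d phi u) by apply: diff_continuous; exact: phi_C1.1.
have tN u v : tangential u (- v) = - tangential u v by rewrite -scaleN1r tangentialZ scaleN1r.
have tD u v w : tangential u (v + w) = tangential u v + tangential u w.
  by rewrite -{1}(opprK w) tangentialB tN opprK.
have dZ u s v : 'd phi u (s *: v) = s * 'd phi u v by rewrite linearZ.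
pose F u := (- (delta / 2)) *: tangential u (Z u).
have d20 : 0 < delta / 2 by rewrite divr_gt0.
have F_le u : `|F u| <= delta / 2.
  rewrite /F normrZ normrN gtr0_norm// -[leRHS]mulr1 ler_pM2l//.
  have [l [l0 l1 _ hl]] := ZP u.
  rewrite (le_trans _ l1)// -[l]mulr1; apply: (hl (fun v => `|tangential u v|)).
  - by move=> v; apply: cvg_norm; exact: tcont.
  - by move=> v w; rewrite tD ler_normD.
  - by move=> s v s0; rewrite tangentialZ normrZ ger0_norm.
  - by move=> v [_ /ltW].
have F_descent u : exists l, [/\ 0 <= l, (closure B0 u -> l = 1) & 'd phi u (F u) <= - (2 * eps * l)].
  have [l [l0 l1 Bl hl]] := ZP u; exists l; split=> //.
  have := hl (fun v => - 'd phi u (tangential u v)) (- (4 * eps / delta)) _ _ _ _.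
  have h1 : continuous (fun v => - 'd phi u (tangential u v)).
    move=> v; apply: cvgN; apply: continuous_comp; first exact: tcont.
    exact: dcont.
  move=> /(_ h1) h.
  have {}h : - 'd phi u (tangential u (Z u)) <= l * - (4 * eps / delta).
    apply: h.
    - by move=> v w; rewrite tD raddfD opprD.
    - by move=> s v s0; rewrite tangentialZ dZ mulrN.
    - by move=> v [_ _ /ltW h _ _]; rewrite lerN2.
  rewrite /F dZ mulNr -mulrN.
  have -> : - (2 * eps * l) = delta / 2 * (l * - (4 * eps / delta)).
    by field; rewrite gt_eqF.
  by rewrite ler_pM2l.
exists F; split=> //.
- have Tl : locally_lipschitz (fun u => tangential u (Z u)).
    by apply: (@tangential_locally_lipschitz id) => //; exact: locally_lipschitz_id.
  apply: (locally_lipschitz_scale (c := fun=> - (delta / 2))) => //; exact: locally_lipschitz_cst.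
- by move=> u; rewrite /F pullbackZr tangential_tangent mulr0.
- move=> u; have [l [l0 _ h]] := F_descent u; apply: (le_trans h).
  by rewrite oppr_le0 mulr_ge0// mulr_ge0// ltW.
split=> [u nu|u u1 ua uS].
  have [l [_ _ _ hl]] := ZP u.
  have : `|Z u| <= l * 0.
    apply: (hl Num.norm) => //.
    - by move=> v; apply: cvg_norm; exact: cvg_id.
    - exact: ler_normD.
    - by move=> s v s0; rewrite normrZ ger0_norm.
    - by move=> v [_ _ _ h1 h2]; case: nu.
  rewrite mulr0 normr_le0 => /eqP Z0.
  have t0 : tangential u 0 = 0 by have := tangentialZ u 0 0; rewrite !scale0r.
  by rewrite /F Z0 t0 scaler0.
have [l [_ Bl]] := F_descent u; rewrite Bl ?mulr1//.
by apply: subset_closure; split.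
Qed.

End DescentField.

(** * The flow on the sphere *)

Section SphereFlow.
Variables (R : realType) (E H : completeNormedModType R).
Variables (ip : {dot H for idfun}) (i : {linear E -> H}).
Hypothesis ip_norm : forall h : H, `|h| = Num.sqrt (ip h h).
Hypothesis i_cont : continuous i.
Variables (F : E -> E) (K : R).
Hypotheses (K_gt0 : 0 < K) (FK : forall x, `|F x| <= K).
Hypothesis Flip : locally_lipschitz F.
Hypothesis F_tangent : forall u, pullback ip i u (F u) = 0.

(** The derivative of [pullback x x] in the direction [F x] is zero; applying the
growth bound to this function and to its opposite gives equality. *)
Lemma flow_pullback u t : 0 <= t ->
  pullback ip i (flow F t u) (flow F t u) = pullback ip i u u.
Proof.
move=> t0; pose N x := pullback ip i x x.
have [C C0 hC] := pullback_bounded ip_norm i_cont.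
have pB := pullbackBr ip i; have pZ := pullbackZr ip i.
have pC := pullbackC ip i.
have Ncont : continuous N.
  apply: locally_lipschitz_continuous; apply: (pullback_locally_lipschitz ip_norm i_cont (f := id) (g := id)).
    exact: locally_lipschitz_id.
  exact: locally_lipschitz_id.
(* The sign [s] treats the function and its opposite together. *)
have key (s : R) : `|s| = 1 -> s * N (flow F t u) <= s * N u.
  move=> s1; have := @flow_growth R E F K K_gt0 FK Flip (fun x => s * N x) 0 (t + 1) u.
  move=> h; rewrite -[leRHS]addr0 -(mulr0 t); apply: h => //; last by lra.
    by move=> x; apply: cvgM; [exact: cvg_cst | exact: Ncont].
  move=> t1 e _ _ e0; set y := flow F t1 u.
  apply: (@flow_derivative R E F K K_gt0 FK Flip (fun x => s * N x)
      (fun v => s * 2 * pullback ip i y v) (2 * C * `|y|)) => //.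
  - by move=> v w; rewrite pB mulrBr.
  - by move=> a v; rewrite pZ; ring.
  - move=> v; rewrite !normrM s1 ger0_norm//; have := hC y v; lra.
  - move=> d d0; exists (d / C); first by rewrite divr_gt0.
    move=> w; rewrite ltr_pdivlMr// => wd.
    have -> : s * N (y + w) - s * N y - s * 2 * pullback ip i y w = s * N w.
      rewrite /N; have -> : pullback ip i (y + w) (y + w) =
          pullback ip i y y + 2 * pullback ip i y w + pullback ip i w w.
        have pD v b c : pullback ip i v (b + c) = pullback ip i v b + pullback ip i v c.
          by rewrite /pullback !raddfD.
        by rewrite pD ![pullback ip i (y + w) _]pC !pD (pC w y); ring.
      by ring.
    rewrite normrM s1 mul1r; apply: (le_trans (hC w w)).
    rewrite mulrA; apply: ler_wpM2r => //; lra.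
  - by rewrite F_tangent mulr0.
have h1 := key 1 (normr1 _); have hN := key (- 1) (_ : `|-1| = 1).
rewrite normrN normr1 in hN; have {}hN := hN erefl.
by apply/eqP; rewrite eq_le; rewrite !mul1r !mulN1r in h1 hN; rewrite /N in h1 hN; lra.
Qed.

Lemma flow_unit_sphere u t : 0 <= t -> unit_sphere i u -> unit_sphere i (flow F t u).
Proof.
move=> t0 u1; rewrite /unit_sphere /=.
have := flow_pullback u t0; rewrite !(@pullback_norm R E H ip i ip_norm) (u1 : `|i u| = 1) expr1n.
by move=> /eqP; rewrite sqrp_eq1// => /eqP.
Qed.

(** The absolute value makes this a self-map of the sphere for every real [t],
the flow being constructed forward in time. *)
Definition sphere_flow (t : R) (u : unit_sphere i) : unit_sphere i :=
  exist _ (flow F `|t| (val u))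
    (mem_set (flow_unit_sphere (normr_ge0 t) (set_mem (valP u)))).

Lemma flow_time_abs s t x : 0 <= s -> 0 <= t ->
  `|flow F s x - flow F t x| <= K * `|s - t|.
Proof.
move=> s0 t0; case/orP: (le_total s t) => st.
  by rewrite distrC ler0_norm ?opprB ?subr_le0//; exact: (flow_time K_gt0 FK).
by rewrite ger0_norm ?subr_ge0//; exact: (flow_time K_gt0 FK).
Qed.

Lemma sphere_flow_continuous :
  continuous (fun tu : R * unit_sphere i => sphere_flow tu.1 tu.2).
Proof.
apply: continuous_comp_initial => -[t u].
apply/cvgrPdist_lt => e e0; rewrite /comp /=.
have e20 : 0 < e / 2 by rewrite divr_gt0.
have [d d0 hd] := flow_continuous K_gt0 FK Flip (val u) (normr_ge0 t) e20.
have eK0 : 0 < e / 2 / K by rewrite divr_gt0.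
have n1 : \forall p \near (t, u), `|t - p.1| < e / 2 / K.
  have : (@fst R (unit_sphere i)) @ (t, u) --> t by exact: cvg_fst.
  by move=> /cvgrPdist_lt/(_ _ eK0).
have n2 : \forall p \near (t, u), `|val u - val p.2| < d.
  have : (val \o (@snd R (unit_sphere i))) @ (t, u) --> (val u : E).
    apply: continuous_comp; first exact: cvg_snd.
    exact: initial_continuous.
  by move=> /cvgrPdist_lt/(_ _ d0).
near=> p.
have h1 : `|t - p.1| < e / 2 / K by near: p.
have /hd h2 : `|val u - val p.2| < d by near: p.
have h3 := flow_time_abs (val p.2) (normr_ge0 t) (normr_ge0 p.1).
have h4 : K * `| (`|t| - `|p.1|) | < e / 2.
  rewrite mulrC -ltr_pdivlMr//; apply: le_lt_trans h1; exact: ler_dist_dist.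
have := ler_distD (flow F `|t| (val p.2)) (flow F `|t| (val u)) (flow F `|p.1| (val p.2)).
lra.
Unshelve. all: by end_near. Qed.

Lemma sphere_flow_continuous_at t : continuous (sphere_flow t).
Proof.
move=> u; apply: (@continuous_comp _ _ _ (fun v => (t, v))
  (fun tu : R * unit_sphere i => sphere_flow tu.1 tu.2)).
  have c1 : (fun _ : unit_sphere i => t) @ u --> t by exact: cst_continuous.
  have c2 : (fun v : unit_sphere i => v) @ u --> u by exact: cvg_id.
  exact: (cvg_pair c1 c2).
exact: sphere_flow_continuous.
Qed.

End SphereFlow.

(** * The deformation *)

Lemma sphere_flow_cancel (R : realType) (E H : completeNormedModType R)
    (ip : {dot H for idfun}) (i : {linear E -> H})
    (ip_norm : forall h : H, `|h| = Num.sqrt (ip h h)) (i_cont : continuous i)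
    (F G : E -> E) (K : R) (K_gt0 : 0 < K)
    (FK : forall x, `|F x| <= K) (GK : forall x, `|G x| <= K)
    (Fl : locally_lipschitz F) (Gl : locally_lipschitz G)
    (Ft : forall u, pullback ip i u (F u) = 0)
    (Gt : forall u, pullback ip i u (G u) = 0) t :
  (forall x, G x = - F x) ->
  cancel (sphere_flow ip_norm i_cont K_gt0 FK Fl Ft t)
         (sphere_flow ip_norm i_cont K_gt0 GK Gl Gt t).
Proof.
move=> GF u; apply: val_inj => /=.
have -> : G = fun x => - F x by apply/funext.
exact: (flow_reverse K_gt0 FK).
Qed.

Theorem lemma2p4 (R : realType) (E H : completeNormedModType R)
  (ip : {dot H for idfun}) (i : {linear E -> H})
  (ip_norm : forall h : H, `|h| = Num.sqrt (ip h h))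
  (E_infdim : infinite_dimensional E) (H_infdim : infinite_dimensional H)
  (EHE : continuous_injections ip i)
  (phi : E -> R) (phi_C1 : continuously_differentiable phi)
  (S : set E) (S_M : S `<=` unit_sphere i)
  (a eps delta : R) (eps_gt0 : 0 < eps) (delta_gt0 : 0 < delta)
  (phi_S : forall u : E,
     (unit_sphere i `&` phi @^-1` `[a - 2 * eps, a + 2 * eps]
        `&` enlargement S (2 * delta)) u ->
     8 * eps / delta <= constrained_derivative_norm ip i phi u) :
  exists eta : R -> unit_sphere i -> unit_sphere i,
    {within `[0, 1] `*` [set: unit_sphere i],
       continuous (fun tu : R * unit_sphere i => eta tu.1 tu.2)} /\
    [/\
        forall (t : R) (u : unit_sphere i), t \in `[0, 1] ->
          t = 0 \/
          ~ (unit_sphere i `&` phi @^-1` `[a - 2 * eps, a + 2 * eps]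
               `&` enlargement S (2 * delta)) (val u) ->
          eta t u = u,
        forall u : unit_sphere i, (sublevel phi (a + eps) `&` S) (val u) ->
          sublevel phi (a - eps) (val (eta 1 u)),
        forall t : R, t \in `[0, 1] -> homeomorphism (eta t),
        forall (u : unit_sphere i) (t : R), t \in `[0, 1] ->
          `|val (eta t u) - val u| <= delta &
        (forall (u : unit_sphere i) (s t : R),
           s \in `[0, 1] -> t \in `[0, 1] -> s <= t ->
           phi (val (eta t u)) <= phi (val (eta s u))) /\
        (forall (u : unit_sphere i) (t : R),
           (unit_sphere i `&` sublevel phi a `&` enlargement S delta) (val u) ->
           t \in `]0, 1] -> phi (val (eta t u)) < a)].
Proof.
have i_cont : continuous i by case: EHE.
have [F [Fl FK Ft Fd [F0 Fdesc]]] :=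
  descent_field ip_norm i_cont phi_C1 eps_gt0 delta_gt0 phi_S.
have K_gt0 : 0 < delta / 2 by rewrite divr_gt0.
have Gl : locally_lipschitz (fun x => - F x).
  move=> x; have [L [r [L0 r0 h]]] := Fl x; exists L, r; split=> // y z xy xz.
  by rewrite -opprD normrN; exact: h.
have GK x : `|- F x| <= delta / 2 by rewrite normrN.
have Gt u : pullback ip i u (- F u) = 0.
  by rewrite -scaleN1r pullbackZr Ft mulr0.
pose eta := sphere_flow ip_norm i_cont K_gt0 FK Fl Ft.
pose eta' := sphere_flow ip_norm i_cont K_gt0 GK Gl Gt.
have etaE t u : 0 <= t -> val (eta t u) = flow F t (val u).
  by move=> t0; rewrite /= ger0_norm.
have phi_cont := C1_continuous phi_C1.
have rate y c : 'd phi y (F y) <= c -> forall e, 0 < e -> exists2 s0, 0 < s0 &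
    forall s, 0 <= s -> s <= s0 -> phi (flow F s y) <= phi y + s * (c + e).
  move=> dc; have [k k0 hk] := differential_bounded phi_C1 y.
  apply: (flow_derivative K_gt0 FK Fl (Df := 'd phi y) (M := k)) => //.
  - by move=> u v; rewrite raddfB.
  - by move=> s v; rewrite linearZ.
  - by apply: differentiable_expansion; exact: phi_C1.1.
have mono u s t : 0 <= s -> s <= t -> phi (flow F t u) <= phi (flow F s u).
  move=> s0 st; have ts : 0 <= t - s by rewrite subr_ge0.
  rewrite -(subrK s t) addrC (flowD K_gt0 FK)//.
  rewrite -[leRHS]addr0 -(mulr0 (t - s)).
  apply: (flow_growth K_gt0 FK Fl (T := t - s)) => // t1 e _ _ e0.
  exact: rate.
have etaS t u : 0 <= t -> `|val (eta t u) - val u| <= delta / 2 * t.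
  by move=> t0; rewrite etaE//; exact: (flow_dist K_gt0 FK).
exists eta; split.
  by apply: continuous_subspaceT; exact: sphere_flow_continuous.
split.
- move=> t u; rewrite in_itv/= => /andP[t0 _] h; apply: val_inj; rewrite etaE//.
  case: h => [->|h]; first exact: (flow0 K_gt0 FK).
  apply: (flow_fixed K_gt0 FK) => //; apply: F0 => -[h1 h2]; apply: h.
  split=> //; split; first exact: set_mem (valP u).
  by rewrite /= in_itv/=; move: h1; rewrite ltr_norml; lra.
- move=> u [ua uS]; have {}ua : phi (val u) <= a + eps by [].
  suff : phi (val (eta 1 u)) <= a - eps by [].
  rewrite etaE// leNgt; apply/negP => lt.
  have eta1 : phi (flow F 1 (val u)) <= phi (val u) + 1 * - (2 * eps).
    apply: (flow_growth K_gt0 FK Fl (T := 1)) => // t e t0 t1 e0.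
    apply: rate => //.
    have h0 := mono (val u) 0 t (lexx 0) t0; rewrite (flow0 K_gt0 FK)// in h0.
    have h2 := mono (val u) t 1 t0 (ltW t1).
    have h3 := etaE t u t0; have h4 := etaS t u t0; rewrite h3 in h4.
    (* The level is still above [a - eps] and the orbit is within [delta / 2] of
       its starting point in [S], so the full descent rate is available. *)
    apply: Fdesc.
    + by rewrite -h3; exact: set_mem (valP (eta t u)).
    + by rewrite ler_norml; lra.
    + exists (val u) => //; rewrite distrC; apply: (le_lt_trans h4).
      have h5 : delta / 2 * t < delta / 2 * 1 by rewrite ltr_pM2l.
      lra.
  lra.
- move=> t _; split.
    exact: sphere_flow_continuous_at.
  exists (eta' t); split.
  + exact: sphere_flow_cancel.
  + by apply: sphere_flow_cancel => x; rewrite opprK.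
  + exact: sphere_flow_continuous_at.
- move=> u t; rewrite in_itv/= => /andP[t0 t1]; apply: (le_trans (etaS t u t0)).
  have : delta / 2 * t <= delta / 2 * 1 by rewrite ler_pM2l.
  lra.
split.
  move=> u s t; rewrite !in_itv/= => /andP[s0 s1] /andP[t0 t1] st.
  by rewrite !ger0_norm//; exact: mono.
move=> u t [[u1 ua] uS]; rewrite in_itv/= => /andP[t0 t1]; rewrite gtr0_norm//.
have h0 := mono (val u) 0 t (lexx 0) (ltW t0); rewrite (flow0 K_gt0 FK)// in h0.
have [lt|ge] := ltP (phi (val u)) a; first exact: le_lt_trans lt.
have pa : phi (val u) = a by apply/eqP; rewrite eq_le ge andbT.
(* At level [a] the field descends strictly, so the orbit drops below [a] at once
   and never comes back up. *)
have [|s0 s00 hs] := rate (val u) (- (2 * eps)) _ eps eps_gt0.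
  by apply: Fdesc => //; rewrite pa subrr normr0 ltW.
pose s := Num.min s0 t.
have s_gt0 : 0 < s by rewrite lt_min s00.
have ss0 : s <= s0 by rewrite ge_min lexx.
have st : s <= t by rewrite ge_min lexx orbT.
have := hs s (ltW s_gt0) ss0; have := mono (val u) s t (ltW s_gt0) st.
have : 0 < s * eps by rewrite mulr_gt0.
by rewrite pa mulrDr mulrN; lra.
Qed.
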